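(* Let $\gamma$ be a Jordan curve with parameter interval $[0,2\pi]$, and let $\upsilon(t)=\exp(it)$ for $0\le t\le 2\pi$. Then (i) the assignment $f:\exp(it)\mapsto\gamma(t)$ $(0\le t\le2\pi)$ is a well-defined, uniformly continuous, injective mapping of the range $\upsilon([0,2\pi])$ onto $\gamma([0,2\pi])$ with uniformly continuous inverse; and (ii) $f$ extends to a uniformly continuous injective mapping $F$ of the unit circle $\mathsf{U}=\{z\in\mathbb{C}:|z|=1\}$ onto $\mathsf{car}(\gamma)$ with uniformly continuous inverse.
   Context: Work in Bishop's constructive mathematics (intuitionistic logic). For complex numbers, $z\neq w$ means $|z-w|>0$. Compact means complete and totally bounded. A path is a uniformly continuous $\gamma:[a,b]\to\mathbb{C}$ with $a<b$ (its parameter interval); closed if $\gamma(a)=\gamma(b)$; its carrier $\mathsf{car}(\gamma)$ is the closure of $\gamma([a,b])$. A Jordan curve is a closed path $\gamma:[a,b]\to\mathbb{C}$ such that (J1) if $(t,t')\in[a,b]\times(a,b)$ and $t\neq t'$ then $\gamma(t)\neq\gamma(t')$; and (J2) for each compact $K\subset(a,b)$, $\gamma^{-1}$ is uniformly continuous on $\gamma(K)$. *)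

(* Defs.v *)
(* The mathematics is Bishop-style constructive, so the reals are an arbitrary
   [R : ConstructiveReals]: points are compared with the setoid equality [==],
   the strict order [<] is informative, and existence is [sigT] rather than
   [exists], so that witnesses may be used in constructions.  No axiom is used. *)
From Stdlib Require Import QArith Qabs Factorial PeanoNat Compare_dec ZArith Lia Setoid Ring.
From Stdlib Require Import ConstructiveReals ConstructiveAbs ConstructiveLimits
  ConstructiveSum ConstructivePower.

Local Open Scope ConstructiveReals.

Section RealLemmas.
Context {R : ConstructiveReals}.
Notation X := (CRcarrier R).

Lemma CR_Q_ring_morph :
  ring_morph (CR_of_Q R 0) (CR_of_Q R 1) (CRplus R) (CRmult R) (CRminus R)
    (CRopp R) (CReq R) 0%Q 1%Q Qplus Qmult Qminus Qopp Qeq_bool (CR_of_Q R).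
Proof.
  constructor; try reflexivity.
  - intros; apply CR_of_Q_plus.
  - intros x y. unfold Qminus, CRminus. rewrite CR_of_Q_plus, CR_of_Q_opp.
    reflexivity.
  - intros; apply CR_of_Q_mult.
  - intros; apply CR_of_Q_opp.
  - intros x y H. apply CR_of_Q_morph, Qeq_bool_iff, H.
Qed.

Lemma CR_ring_theory :
  ring_theory (CR_of_Q R 0) (CR_of_Q R 1) (CRplus R) (CRmult R) (CRminus R)
    (CRopp R) (CReq R).
Proof. exact (CRisRing R). Qed.

Ltac CR_cst t :=
  match t with
  | CR_of_Q _ ?q => match isQcst q with true => q | _ => constr:(InitialRing.NotConstant) end
  | _ => constr:(InitialRing.NotConstant)
  end.
Add Ring CRring : CR_ring_theory
  (morphism CR_Q_ring_morph, setoid (CReq_rel (R:=R)) (CRisRingExt R), constants [CR_cst]).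

Lemma CRle_of_diff : forall a b e : X, 0 <= e -> b - a == e -> a <= b.
Proof.
  intros a b e He H. apply (CRplus_le_reg_r (- a)).
  assert (H1 : a + - a == 0) by ring. rewrite H1.
  unfold CRminus in H. rewrite H. exact He.
Qed.

Lemma CRle_sub : forall a b : X, a <= b -> 0 <= b - a.
Proof. intros; apply CRle_minus; assumption. Qed.

Lemma CRsq_le : forall a b : X, 0 <= a -> a <= b -> a * a <= b * b.
Proof.
  intros a b Ha Hab. apply (CRle_trans _ (a * b)).
  - apply CRmult_le_compat_l; assumption.
  - apply CRmult_le_compat_r; [|assumption]. apply (CRle_trans _ a); assumption.
Qed.

Lemma CRsq_le_cancel : forall a b : X, 0 <= b -> a * a <= b * b -> a <= b.
Proof.
  intros a b Hb H Hlt. apply H. clear H.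
  assert (Ha : 0 < a) by (apply (CRle_lt_trans _ b); assumption).
  apply (CRle_lt_trans _ (b * a)).
  - apply CRmult_le_compat_l; [assumption | apply CRlt_asym, Hlt].
  - apply CRmult_lt_compat_r; assumption.
Qed.

Lemma CRle_0_of_all_inv : forall x c : X,
  (forall p : positive, x <= c * CR_of_Q R (1 # p)) -> x <= 0.
Proof.
  intros x c H Hx.
  destruct (CR_Q_dense R 0 x Hx) as [q [Hq1 Hq2]].
  apply lt_CR_of_Q in Hq1.
  destruct (CR_archimedean R c) as [n Hn].
  destruct q as [num den].
  destruct num as [|num|num]; try (unfold Qlt in Hq1; simpl in Hq1; lia).
  apply (H (n * den)%positive).
  apply (CRle_lt_trans _ (CR_of_Q R (Z.pos n # 1) * CR_of_Q R (1 # n * den))).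
  { apply CRmult_le_compat_r; [|apply CRlt_asym, Hn].
    apply CR_of_Q_le. unfold Qle; simpl; lia. }
  apply (CRle_lt_trans _ (CR_of_Q R (Z.pos num # den))); [|exact Hq2].
  rewrite <- CR_of_Q_mult. apply CR_of_Q_le. unfold Qle, Qmult; simpl. nia.
Qed.

Lemma CRsqrt_search : forall (a : X) (p : positive), 0 <= a -> forall m : nat,
  a <= CR_of_Q R (Z.of_nat m # p) * CR_of_Q R (Z.of_nat m # p) ->
  { q : Q & (0 <= CR_of_Q R q) /\ (CR_of_Q R q * CR_of_Q R q <= a) /\
    (a <= (CR_of_Q R q + CR_of_Q R (2 # p)) * (CR_of_Q R q + CR_of_Q R (2 # p))) }.
Proof.
  intros a p Ha. induction m as [|m IH]; intros Hm.
  - exists 0%Q. split; [apply CRle_refl|]. split.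
    + rewrite <- CR_of_Q_mult. exact Ha.
    + apply (CRle_trans _ _ _ Hm). rewrite <- CR_of_Q_plus, <- !CR_of_Q_mult.
      apply CR_of_Q_le. unfold Qle, Qmult, Qplus; simpl. nia.
  - destruct (le_lt_dec (S m) 2) as [Hm2|Hm2].
    { exists 0%Q. split; [apply CRle_refl|]. split.
      + rewrite <- CR_of_Q_mult. exact Ha.
      + apply (CRle_trans _ _ _ Hm). rewrite <- CR_of_Q_plus.
        apply CRsq_le; apply CR_of_Q_le; unfold Qle, Qplus; simpl; nia. }
    destruct m as [|m]; [lia|].
    assert (Hlt : CR_of_Q R (Z.of_nat m # p) * CR_of_Q R (Z.of_nat m # p)
                  < CR_of_Q R (Z.of_nat (S m) # p) * CR_of_Q R (Z.of_nat (S m) # p)).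
    { rewrite <- !CR_of_Q_mult. apply CR_of_Q_lt. unfold Qlt, Qmult.
      cbn [Qnum Qden]. nia. }
    destruct (CRltLinear R) as [_ cotr].
    destruct (cotr _ a _ Hlt) as [H|H].
    + exists (Z.of_nat m # p)%Q. split; [|split].
      * apply CR_of_Q_le; unfold Qle; simpl; lia.
      * apply CRlt_asym, H.
      * apply (CRle_trans _ _ _ Hm). rewrite <- CR_of_Q_plus.
        apply CRsq_le; apply CR_of_Q_le; unfold Qle, Qplus; cbn [Qnum Qden]; nia.
    + apply IH. apply CRlt_asym, H.
Qed.

Lemma CRsqrt_approx : forall (a : X), 0 <= a -> forall (p : positive),
  { q : Q & (0 <= CR_of_Q R q) /\ (CR_of_Q R q * CR_of_Q R q <= a) /\
    (a <= (CR_of_Q R q + CR_of_Q R (2 # p)) * (CR_of_Q R q + CR_of_Q R (2 # p))) }.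
Proof.
  intros a Ha p. destruct (CR_archimedean R a) as [n Hn].
  apply (CRsqrt_search a p Ha (Pos.to_nat (n * p))).
  apply (CRle_trans _ _ _ (CRlt_asym _ _ Hn)). rewrite <- CR_of_Q_mult.
  apply CR_of_Q_le. unfold Qle, Qmult; cbn [Qnum Qden]. nia.
Qed.

Lemma CRsqrt_exists : forall a : X, 0 <= a -> { s : X | 0 <= s /\ s * s == a }.
Proof.
  intros a Ha.
  pose (q := fun p => projT1 (CRsqrt_approx a Ha p)).
  assert (Hq : forall p, (0 <= CR_of_Q R (q p)) /\ (CR_of_Q R (q p) * CR_of_Q R (q p) <= a)
    /\ (a <= (CR_of_Q R (q p) + CR_of_Q R (2 # p)) * (CR_of_Q R (q p) + CR_of_Q R (2 # p)))).
  { intro p. unfold q. destruct (CRsqrt_approx a Ha p). assumption. }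
  assert (H2p : forall p, 0 <= CR_of_Q R (2 # p)).
  { intro p. apply CR_of_Q_le. unfold Qle; simpl; lia. }
  assert (Hqq : forall p r, CR_of_Q R (q p) <= CR_of_Q R (q r) + CR_of_Q R (2 # r)).
  { intros p r. destruct (Hq p) as [_ [Hp _]], (Hq r) as [Hr0 [_ Hr]].
    apply CRsq_le_cancel.
    - rewrite <- (CRplus_0_l 0). apply CRplus_le_compat; [assumption|apply H2p].
    - apply (CRle_trans _ a); assumption. }
  pose (u := fun n => CR_of_Q R (q (Pos.of_nat (S n)))).
  assert (Hcau : CR_cauchy R u).
  { intro p. exists (Pos.to_nat (2 * p)). intros i j Hi Hj.
    assert (Hsm : forall k, (Pos.to_nat (2 * p) <= k)%nat ->
       CR_of_Q R (2 # Pos.of_nat (S k)) <= CR_of_Q R (1 # p)).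
    { intros k Hk. apply CR_of_Q_le. unfold Qle; cbn [Qnum Qden]. lia. }
    apply CRabs_le. unfold u. split.
    - apply (CRle_of_diff _ _ ((CR_of_Q R (q (Pos.of_nat (S i))) + CR_of_Q R (2 # Pos.of_nat (S i))
         - CR_of_Q R (q (Pos.of_nat (S j)))) + (CR_of_Q R (1 # p) - CR_of_Q R (2 # Pos.of_nat (S i))))).
      + rewrite <- (CRplus_0_l 0). apply CRplus_le_compat; apply CRle_sub; auto.
      + ring.
    - apply (CRle_of_diff _ _ ((CR_of_Q R (q (Pos.of_nat (S j))) + CR_of_Q R (2 # Pos.of_nat (S j))
         - CR_of_Q R (q (Pos.of_nat (S i)))) + (CR_of_Q R (1 # p) - CR_of_Q R (2 # Pos.of_nat (S j))))).
      + rewrite <- (CRplus_0_l 0). apply CRplus_le_compat; apply CRle_sub; auto.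
      + ring. }
  destruct (CR_complete R u Hcau) as [s Hs].
  exists s.
  assert (Hs0 : 0 <= s).
  { apply (CR_cv_bound_down u 0 s 0); [|exact Hs]. intros n _. apply Hq. }
  split; [exact Hs0|].
  assert (Hup : forall p, s <= CR_of_Q R (q p) + CR_of_Q R (2 # p)).
  { intro p. apply (CR_cv_bound_up u _ s 0); [|exact Hs]. intros n _. apply Hqq. }
  assert (Hlow : forall p, CR_of_Q R (q p) <= s).
  { intro p.
    apply (CRle_of_diff _ _ (- (CR_of_Q R (q p) - s))); [|ring].
    rewrite <- CRopp_0. apply CRopp_ge_le_contravar.
    apply (CRle_0_of_all_inv _ 1). intro r.
    destruct (Hs (2 * r)%positive) as [N HN].
    pose (k := Nat.max N (Pos.to_nat (4 * r))).
    assert (Hk := HN k ltac:(lia)). apply CRabs_def2 in Hk. destruct Hk as [Hk _].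
    assert (Hk2 := Hqq p (Pos.of_nat (S k))). fold (u k) in Hk2.
    assert (Hk3 : CR_of_Q R (2 # Pos.of_nat (S k)) <= CR_of_Q R (1 # (2 * r))).
    { apply CR_of_Q_le. unfold Qle; cbn [Qnum Qden]. lia. }
    assert (E : CR_of_Q R (1 # r) == CR_of_Q R (1 # 2 * r) + CR_of_Q R (1 # 2 * r)).
    { rewrite <- CR_of_Q_plus. apply CR_of_Q_morph. unfold Qeq, Qplus; cbn [Qnum Qden]. lia. }
    rewrite E.
    apply (CRle_of_diff _ _ ((u k + CR_of_Q R (2 # Pos.of_nat (S k)) - CR_of_Q R (q p))
      + (CR_of_Q R (1 # 2 * r) - (u k - s))
      + (CR_of_Q R (1 # 2 * r) - CR_of_Q R (2 # Pos.of_nat (S k))))).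
    - rewrite <- (CRplus_0_l 0). apply CRplus_le_compat; [|apply CRle_sub, Hk3].
      rewrite <- (CRplus_0_l 0). apply CRplus_le_compat; apply CRle_sub; assumption.
    - ring. }
  assert (E2 : forall p, CR_of_Q R (2 # p) == CR_of_Q R 2 * CR_of_Q R (1 # p)).
  { intro p. rewrite <- CR_of_Q_mult. reflexivity. }
  assert (Hbnd : forall p,
    (CR_of_Q R (q p) + CR_of_Q R (2 # p)) * (CR_of_Q R (q p) + CR_of_Q R (2 # p))
    - CR_of_Q R (q p) * CR_of_Q R (q p) <= (CR_of_Q R 4 * s + CR_of_Q R 4) * CR_of_Q R (1 # p)).
  { intro p. rewrite E2.
    assert (H1p : 0 <= CR_of_Q R (1 # p)).
    { apply CR_of_Q_le. unfold Qle; simpl; lia. }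
    apply (CRle_of_diff _ _ (CR_of_Q R 4 * (s - CR_of_Q R (q p)) * CR_of_Q R (1 # p)
       + CR_of_Q R 4 * CR_of_Q R (1 # p) * (1 - CR_of_Q R (1 # p)))).
    - assert (H4 : 0 <= CR_of_Q R 4) by (apply CR_of_Q_le; discriminate).
      rewrite <- (CRplus_0_l 0). apply CRplus_le_compat;
      repeat apply CRmult_le_0_compat; try assumption; apply CRle_sub.
      + apply Hlow.
      + apply CR_of_Q_le. unfold Qle; simpl; lia.
    - ring. }
  split.
  - apply (CRle_of_diff _ _ (- (a - s * s))); [|ring].
    rewrite <- CRopp_0. apply CRopp_ge_le_contravar.
    apply (CRle_0_of_all_inv _ (CR_of_Q R 4 * s + CR_of_Q R 4)). intro p.
    apply (CRle_trans _ _ _ ) with (2 := Hbnd p).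
    apply CRplus_le_compat; [apply Hq|]. apply CRopp_ge_le_contravar.
    apply CRsq_le; [apply Hq|apply Hlow].
  - apply (CRle_of_diff _ _ (- (s * s - a))); [|ring].
    rewrite <- CRopp_0. apply CRopp_ge_le_contravar.
    apply (CRle_0_of_all_inv _ (CR_of_Q R 4 * s + CR_of_Q R 4)). intro p.
    apply (CRle_trans _ _ _ ) with (2 := Hbnd p).
    apply CRplus_le_compat.
    + apply CRsq_le; [assumption|apply Hup].
    + apply CRopp_ge_le_contravar. apply Hq.
Qed.

Definition CRsqrt (a : X) (Ha : 0 <= a) : X := proj1_sig (CRsqrt_exists a Ha).

Lemma CRsq_nonneg : forall x : X, 0 <= x * x.
Proof.
  intros x H.
  assert (Hx : 0 <= x).
  { intro Hneg. apply (CRlt_asym _ _ H).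
    assert (E : x * x == (- x) * (- x)) by ring. rewrite E.
    assert (Hp : 0 < - x) by (rewrite <- CRopp_0; apply CRopp_gt_lt_contravar, Hneg).
    apply CRmult_lt_0_compat; exact Hp. }
  exact (CRmult_le_0_compat x x Hx Hx H).
Qed.

Lemma CRsumsq_nonneg : forall x y : X, 0 <= x * x + y * y.
Proof.
  intros x y. rewrite <- (CRplus_0_l 0).
  apply CRplus_le_compat; apply CRsq_nonneg.
Qed.

Definition complex : Set := (X * X)%type.
Definition Cre (z : complex) : X := fst z.
Definition Cim (z : complex) : X := snd z.
Lemma CreE : forall a b : X, Cre (a, b) = a. Proof. reflexivity. Qed.
Lemma CimE : forall a b : X, Cim (a, b) = b. Proof. reflexivity. Qed.
Definition Cminus (z w : complex) : complex := (Cre z - Cre w, Cim z - Cim w).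
Definition Cmult (z w : complex) : complex :=
  (Cre z * Cre w - Cim z * Cim w, Cre z * Cim w + Cim z * Cre w).
Definition Cone : complex := (1, 0).
Definition Ci : complex := (0, 1).
Definition C_of_R (x : X) : complex := (x, 0).
Definition Cabs (z : complex) : X :=
  CRsqrt (Cre z * Cre z + Cim z * Cim z) (CRsumsq_nonneg (Cre z) (Cim z)).
Fixpoint Cpow (z : complex) (n : nat) : complex :=
  match n with O => Cone | S n => Cmult z (Cpow z n) end.

Definition invfact (n : nat) : X := CR_of_Q R (1 # Pos.of_nat (fact n)).

Lemma CRpow_le : forall (x y : X) n, 0 <= x -> x <= y -> CRpow x n <= CRpow y n.
Proof.
  intros x y n Hx Hxy. induction n as [|n IH]; simpl; [apply CRle_refl|].
  apply (CRle_trans _ (x * CRpow y n)).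
  - apply CRmult_le_compat_l; assumption.
  - apply CRmult_le_compat_r; [|assumption].
    apply CRpow_ge_zero, (CRle_trans _ x); assumption.
Qed.

Lemma pow_fact_bound : forall K n : nat, (1 <= K)%nat -> (K ^ n <= K ^ K * fact n)%nat.
Proof.
  intros K n HK. induction n as [|n IH].
  - simpl. assert (H := Nat.pow_le_mono_r K 0 K ltac:(lia) ltac:(lia)).
    simpl in H. lia.
  - destruct (le_lt_dec (S n) K) as [H|H].
    + assert (H1 := Nat.pow_le_mono_r K (S n) K ltac:(lia) H).
      assert (H2 := lt_O_fact (S n)). nia.
    + change (fact (S n)) with (S n * fact n)%nat.
      change (K ^ S n)%nat with (K * K ^ n)%nat. nia.
Qed.

Lemma CRpow_nat : forall K n : nat,
  CRpow (CR_of_Q R (Z.of_nat K # 1)) n == CR_of_Q R (Z.of_nat (K ^ n) # 1).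
Proof.
  intros K n. induction n as [|n IH]; [reflexivity|].
  change (CRpow (CR_of_Q R (Z.of_nat K # 1)) (S n)) with
    (CR_of_Q R (Z.of_nat K # 1) * CRpow (CR_of_Q R (Z.of_nat K # 1)) n).
  rewrite IH, <- CR_of_Q_mult. apply CR_of_Q_morph.
  change (K ^ S n)%nat with (K * K ^ n)%nat.
  unfold Qeq, Qmult; cbn [Qnum Qden]. lia.
Qed.

Lemma invfact_nonneg : forall n, 0 <= invfact n.
Proof. intro n. apply CR_of_Q_le. unfold Qle; simpl; lia. Qed.

Lemma exp_real_cv : forall x : X, 0 <= x ->
  { s : X & series_cv (fun n => CRpow x n * invfact n) s }.
Proof.
  intros x Hx. destruct (CR_archimedean R (x * CR_of_Q R 2)) as [K HK].
  assert (HK' : x <= CR_of_Q R (1 # 2) * CR_of_Q R (Z.of_nat (Pos.to_nat K) # 1)).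
  { rewrite Znat.positive_nat_Z.
    apply (CRle_of_diff _ _ (CR_of_Q R (1 # 2) * (CR_of_Q R (Z.pos K # 1) - x * CR_of_Q R 2))).
    - apply CRmult_le_0_compat; [apply CR_of_Q_le; discriminate|].
      apply CRle_sub, CRlt_asym, HK.
    - ring. }
  revert HK'. generalize (Pos.to_nat K), (Pos2Nat.is_pos K). intros k Hk Hxk.
  destruct (series_cv_maj (fun n => CRpow x n * invfact n)
    (fun n => CRpow (CR_of_Q R (1 # 2)) n * CR_of_Q R (Z.of_nat (k ^ k) # 1))
    (CR_of_Q R 2 * CR_of_Q R (Z.of_nat (k ^ k) # 1))) as [s [Hs _]].
  - intro n. rewrite CRabs_right.
    2: { apply CRmult_le_0_compat; [apply CRpow_ge_zero, Hx|apply invfact_nonneg]. }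
    apply (CRle_trans _ (CRpow (CR_of_Q R (1 # 2) * CR_of_Q R (Z.of_nat k # 1)) n * invfact n)).
    { apply CRmult_le_compat_r; [apply invfact_nonneg|]. apply CRpow_le; assumption. }
    rewrite <- CRpow_mult, CRmult_assoc. apply CRmult_le_compat_l.
    { apply CRpow_ge_zero, CR_of_Q_le. discriminate. }
    rewrite CRpow_nat. unfold invfact. rewrite <- CR_of_Q_mult. apply CR_of_Q_le.
    unfold Qle, Qmult; cbn [Qnum Qden].
    assert (H := pow_fact_bound k n ltac:(lia)). assert (Hf := lt_O_fact n).
    rewrite Z.mul_1_r, Pos.mul_1_l, Z.mul_1_r.
    replace (Z.pos (Pos.of_nat (fact n))) with (Z.of_nat (fact n)) by lia.
    rewrite <- Nat2Z.inj_mul. lia.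
  - apply series_cv_scale, GeoHalfTwo.
  - exists s. exact Hs.
Qed.

Lemma Cpow_bound : forall (z : complex) n,
  CRabs R (Cre (Cpow z n)) <= CRpow (CRabs R (Cre z) + CRabs R (Cim z)) n /\
  CRabs R (Cim (Cpow z n)) <= CRpow (CRabs R (Cre z) + CRabs R (Cim z)) n.
Proof.
  intros [x y] n. unfold Cre, Cim.
  assert (HM : forall a b c d m : X, CRabs R c <= m -> CRabs R d <= m ->
    CRabs R a * CRabs R c + CRabs R b * CRabs R d <= (CRabs R a + CRabs R b) * m).
  { intros a b c d m Hc Hd. rewrite CRmult_plus_distr_r.
    apply CRplus_le_compat; apply CRmult_le_compat_l; auto using CRabs_pos. }
  induction n as [|n [IHr IHi]].
  - simpl. split; rewrite CRabs_right; try apply CRle_refl;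
    apply CR_of_Q_le; discriminate.
  - simpl. unfold Cre, Cim. destruct (Cpow (x, y) n) as [c d]. simpl in *. split.
    + apply (CRle_trans _ (CRabs R x * CRabs R c + CRabs R y * CRabs R d)).
      * unfold CRminus. apply (CRle_trans _ _ _ (CRabs_triang _ _)).
        rewrite CRabs_opp, !CRabs_mult. apply CRle_refl.
      * apply HM; assumption.
    + apply (CRle_trans _ (CRabs R x * CRabs R d + CRabs R y * CRabs R c)).
      * apply (CRle_trans _ _ _ (CRabs_triang _ _)).
        rewrite !CRabs_mult. apply CRle_refl.
      * apply HM; assumption.
Qed.

Definition Cseries_cv (u : nat -> complex) (s : complex) : Set :=
  (series_cv (fun n => Cre (u n)) (Cre s) * series_cv (fun n => Cim (u n)) (Cim s))%type.

Definition Cexp_term (z : complex) (n : nat) : complex :=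
  Cmult (Cpow z n) (C_of_R (invfact n)).

Lemma Cexp_exists : forall z : complex, { s : complex & Cseries_cv (Cexp_term z) s }.
Proof.
  intro z. pose (M := CRabs R (Cre z) + CRabs R (Cim z)).
  destruct (exp_real_cv M) as [s Hs].
  { unfold M. rewrite <- (CRplus_0_l 0). apply CRplus_le_compat; apply CRabs_pos. }
  assert (Hmaj : forall (a : X) n, CRabs R a <= CRpow M n ->
    CRabs R (a * invfact n) <= CRpow M n * invfact n).
  { intros a n Ha. rewrite CRabs_mult, (CRabs_right (invfact n)); [|apply invfact_nonneg].
    apply CRmult_le_compat_r; [apply invfact_nonneg|exact Ha]. }
  destruct (series_cv_maj (fun n => Cre (Cexp_term z n)) (fun n => CRpow M n * invfact n) s)
    as [re [Hre _]]; [|exact Hs|].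
  { intro n. unfold Cexp_term, Cmult, C_of_R, Cre at 1. simpl.
    assert (E : Cre (Cpow z n) * invfact n - Cim (Cpow z n) * 0
                == Cre (Cpow z n) * invfact n) by ring.
    rewrite E. apply Hmaj, (proj1 (Cpow_bound z n)). }
  destruct (series_cv_maj (fun n => Cim (Cexp_term z n)) (fun n => CRpow M n * invfact n) s)
    as [im [Him _]]; [|exact Hs|].
  { intro n. unfold Cexp_term, Cmult, C_of_R, Cim at 1. simpl.
    assert (E : Cre (Cpow z n) * 0 + Cim (Cpow z n) * invfact n
                == Cim (Cpow z n) * invfact n) by ring.
    rewrite E. apply Hmaj, (proj2 (Cpow_bound z n)). }
  exists (re, im). split; assumption.
Qed.

Definition Cexp (z : complex) : complex := projT1 (Cexp_exists z).
(* exp(it) *)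
Definition cis (t : X) : complex := Cexp (Cmult Ci (C_of_R t)).
Definition CRcos (t : X) : X := Cre (cis t).

(* [cosq u] is the sum of the alternating series with terms u^k/(2k)!, so that
   cos t = cosq (t^2).  It is strictly decreasing on [0,3] and vanishes there. *)

Definition CRsgn (n : nat) : X := CRpow (CR_of_Q R (-1)) n.
Definition cosq_term (u : X) (k : nat) : X := CRpow u k * invfact (2 * k) * CRsgn k.

Lemma CRsgn_abs : forall n, CRabs R (CRsgn n) == 1.
Proof.
  unfold CRsgn. induction n as [|n IH]; simpl.
  - apply CRabs_right, CR_of_Q_le. discriminate.
  - rewrite CRabs_mult, IH, CR_of_Q_abs. simpl. ring.
Qed.

Lemma CRpow_abs : forall (u : X) n, CRabs R (CRpow u n) == CRpow (CRabs R u) n.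
Proof.
  intros u n. induction n as [|n IH]; simpl.
  - apply CRabs_right, CR_of_Q_le. discriminate.
  - rewrite CRabs_mult, IH. reflexivity.
Qed.

Lemma invfact_le : forall m n, (m <= n)%nat -> invfact n <= invfact m.
Proof.
  intros m n H. apply CR_of_Q_le. unfold Qle; cbn [Qnum Qden].
  assert (Hf := fact_le m n H). assert (H0 := lt_O_fact m). lia.
Qed.

Lemma cosq_exists : forall u : X, { s : X & series_cv (cosq_term u) s }.
Proof.
  intro u. destruct (exp_real_cv (CRabs R u) (CRabs_pos u)) as [s Hs].
  destruct (series_cv_maj (cosq_term u) (fun n => CRpow (CRabs R u) n * invfact n) s) as [l [Hl _]]; [|exact Hs|].
  - intro n. unfold cosq_term.
    rewrite !CRabs_mult, CRsgn_abs, CRpow_abs, CRmult_1_r.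
    rewrite (CRabs_right (invfact (2 * n))); [|apply invfact_nonneg].
    apply CRmult_le_compat_l; [apply CRpow_ge_zero, CRabs_pos|].
    apply invfact_le. lia.
  - exists l. exact Hl.
Qed.

Definition cosq (u : X) : X := projT1 (cosq_exists u).

Lemma Cpow_imag : forall (z : complex) (t : X), Cre z == 0 -> Cim z == t ->
  forall k, Cre (Cpow z (2 * k)) == CRpow (t * t) k * CRsgn k
    /\ Cim (Cpow z (2 * k)) == 0 /\ Cre (Cpow z (S (2 * k))) == 0.
Proof.
  intros z t Hre Him k.
  assert (H : Cre (Cpow z (2 * k)) == CRpow (t * t) k * CRsgn k
    /\ Cim (Cpow z (2 * k)) == 0).
  { induction k as [|k [IHr IHi]].
    - unfold CRsgn. simpl. split; ring.
    - replace (2 * S k)%nat with (S (S (2 * k))) by lia.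
      cbn [Cpow]. revert IHr IHi. generalize (Cpow z (2 * k)); intros w Hr Hi.
      unfold Cmult, CRsgn in *. rewrite !CreE, !CimE. cbn [CRpow].
      rewrite Hre, Him, Hr, Hi. split; ring. }
  destruct H as [Hr Hi]. split; [exact Hr|]. split; [exact Hi|].
  cbn [Cpow]. unfold Cmult. rewrite CreE.
  rewrite Hre, Hi. ring.
Qed.

Lemma CRcos_cosq : forall t : X, CRcos t == cosq (t * t).
Proof.
  intro t. unfold CRcos, cis, Cexp, cosq.
  set (z := Cmult Ci (C_of_R t)).
  assert (Hz : Cre z == 0 /\ Cim z == t).
  { unfold z, Cmult, Ci, C_of_R, Cre, Cim. simpl. split; ring. }
  destruct (Cexp_exists z) as [[re im] [Hs Hs']].
  destruct (cosq_exists (t * t)) as [l Hl]. cbn [projT1]. rewrite CreE in *.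
  assert (Hterm : forall n, Cre (Cexp_term z n) == Cre (Cpow z n) * invfact n).
  { intro n. unfold Cexp_term, Cmult, C_of_R. rewrite !CreE, !CimE. ring. }
  assert (Hsum : forall n, CRsum (fun k => Cre (Cexp_term z k)) (2 * n)
                           == CRsum (cosq_term (t * t)) n).
  { induction n as [|n IH].
    - assert (H := proj1 (Cpow_imag z t (proj1 Hz) (proj2 Hz) 0)).
      change (2 * 0)%nat with O in *. cbn [CRsum]. rewrite Hterm, H.
      unfold cosq_term. change (2 * 0)%nat with O. ring.
    - replace (2 * S n)%nat with (S (S (2 * n))) by lia.
      cbn [CRsum]. rewrite IH, !Hterm.
      rewrite (proj2 (proj2 (Cpow_imag z t (proj1 Hz) (proj2 Hz) n))).
      replace (S (S (2 * n))) with (2 * S n)%nat by lia.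
      rewrite (proj1 (Cpow_imag z t (proj1 Hz) (proj2 Hz) (S n))).
      unfold cosq_term. ring. }
  apply (CR_cv_unique (CRsum (cosq_term (t * t)))); [|exact Hl].
  apply (CR_cv_eq _ (fun n => CRsum (fun k => Cre (Cexp_term z k)) (2 * n))).
  - exact Hsum.
  - intro p. destruct (Hs p) as [N HN]. exists N. intros i Hi. apply HN. lia.
Qed.

Lemma alt_sum_bounds : forall n (a : nat -> X), (forall k, 0 <= a k) ->
  (forall k, a (S k) <= a k * CR_of_Q R (1 # 2)) ->
  CRsum (fun k => a k * CRsgn k) n <= a O /\
  a O - a (S O) <= CRsum (fun k => a k * CRsgn k) n.
Proof.
  induction n as [|n IH]; intros a Hpos Hdec.
  - unfold CRsgn. simpl. split.
    + rewrite CRmult_1_r. apply CRle_refl.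
    + apply (CRle_of_diff _ _ (a 1%nat)); [apply Hpos|]. ring.
  - rewrite decomp_sum; [|lia]. simpl.
    assert (E : CRsum (fun i => a (S i) * CRsgn (S i)) n
                == - CRsum (fun i => a (S i) * CRsgn i) n).
    { rewrite <- sum_opp. apply CRsum_eq. intros i _. unfold CRsgn. simpl. ring. }
    rewrite E. destruct (IH (fun k => a (S k)) (fun k => Hpos (S k)) (fun k => Hdec (S k)))
      as [IH1 IH2]. unfold CRsgn at 1 3. simpl. split.
    + apply (CRle_of_diff _ _ ((CRsum (fun k => a (S k) * CRsgn k) n - (a 1%nat - a 2%nat))
        + ((a 1%nat * CR_of_Q R (1#2) - a 2%nat) + a 1%nat * CR_of_Q R (1#2)))).
      * rewrite <- (CRplus_0_l 0). apply CRplus_le_compat; [apply CRle_sub, IH2|].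
        rewrite <- (CRplus_0_l 0). apply CRplus_le_compat; [apply CRle_sub, Hdec|].
        apply CRmult_le_0_compat; [apply Hpos|]. apply CR_of_Q_le. discriminate.
      * ring.
    + apply (CRle_of_diff _ _ (a 1%nat - CRsum (fun k => a (S k) * CRsgn k) n)).
      * apply CRle_sub, IH1.
      * ring.
Qed.

(* The sum of u^i v^j over i + j = k. *)
Fixpoint pow2sum (u v : X) (k : nat) : X :=
  match k with O => 1 | S k => u * pow2sum u v k + CRpow v (S k) end.

Lemma pow2sum_diff : forall u v k,
  CRpow u (S k) - CRpow v (S k) == (u - v) * pow2sum u v k.
Proof.
  intros u v. induction k as [|k IH].
  - simpl. ring.
  - assert (E : CRpow u (S (S k)) - CRpow v (S (S k)) ==
      u * (CRpow u (S k) - CRpow v (S k)) + (u - v) * CRpow v (S k)) by (simpl; ring).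
    rewrite E, IH. simpl. ring.
Qed.

Definition cosq_slope (u v : X) (n : nat) : X :=
  CRsum (fun k => pow2sum u v k * invfact (2 * S k) * CRsgn k) n.

Lemma cosq_sum_diff : forall u v n,
  CRsum (cosq_term u) (S n) - CRsum (cosq_term v) (S n) == (v - u) * cosq_slope u v n.
Proof.
  intros u v. unfold cosq_slope.
  assert (E : forall k, cosq_term u (S k) - cosq_term v (S k)
     == (v - u) * (pow2sum u v k * invfact (2 * S k) * CRsgn k)).
  { intro k. unfold cosq_term.
    assert (E1 : CRpow u (S k) * invfact (2 * S k) * CRsgn (S k)
      - CRpow v (S k) * invfact (2 * S k) * CRsgn (S k)
      == (CRpow u (S k) - CRpow v (S k)) * invfact (2 * S k) * CRsgn (S k)) by ring.
    rewrite E1, pow2sum_diff. unfold CRsgn.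
    change (CRpow (CR_of_Q R (-1)) (S k)) with (CR_of_Q R (-1) * CRpow (CR_of_Q R (-1)) k).
    ring. }
  induction n as [|n IH].
  - cbn [CRsum]. rewrite <- E. unfold cosq_term at 1 3. simpl. ring.
  - cbn [CRsum] in *. rewrite CRmult_plus_distr_l, <- IH, <- E. ring.
Qed.

Lemma pow2sum_bound : forall u v k, 0 <= u -> u <= CR_of_Q R 3 -> 0 <= v -> v <= CR_of_Q R 3 ->
  CRpow v k <= pow2sum u v k /\ pow2sum u v (S k) <= CR_of_Q R 6 * pow2sum u v k.
Proof.
  intros u v k Hu Hu3 Hv Hv3.
  assert (H : forall k, CRpow v k <= pow2sum u v k).
  { induction k0 as [|m IH]; [apply CRle_refl|]. cbn [pow2sum].
    apply (CRle_of_diff _ _ (u * pow2sum u v m)); [|ring].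
    apply CRmult_le_0_compat; [assumption|].
    apply (CRle_trans _ (CRpow v m)); [apply CRpow_ge_zero, Hv | exact IH]. }
  split; [apply H|]. cbn [pow2sum CRpow].
  assert (H0 : 0 <= pow2sum u v k).
  { apply (CRle_trans _ (CRpow v k)); [apply CRpow_ge_zero, Hv | apply H]. }
  apply (CRle_of_diff _ _ ((CR_of_Q R 3 - u) * pow2sum u v k
    + (CR_of_Q R 3 * (pow2sum u v k - CRpow v k) + (CR_of_Q R 3 - v) * CRpow v k))).
  - assert (H3 : 0 <= CR_of_Q R 3) by (apply CR_of_Q_le; discriminate).
    rewrite <- (CRplus_0_l 0). apply CRplus_le_compat.
    + apply CRmult_le_0_compat; [apply CRle_sub|]; assumption.
    + rewrite <- (CRplus_0_l 0). apply CRplus_le_compat.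
      * apply CRmult_le_0_compat; [assumption|]. apply CRle_sub, H.
      * apply CRmult_le_0_compat; [apply CRle_sub; assumption|]. apply CRpow_ge_zero, Hv.
  - ring.
Qed.

Lemma cosq_slope_bounds : forall u v n,
  0 <= u -> u <= CR_of_Q R 3 -> 0 <= v -> v <= CR_of_Q R 3 ->
  cosq_slope u v n <= CR_of_Q R (1 # 2) /\
  CR_of_Q R (1 # 2) - (u + v) * CR_of_Q R (1 # 24) <= cosq_slope u v n.
Proof.
  intros u v n Hu Hu3 Hv Hv3. unfold cosq_slope.
  assert (Hp : forall k, 0 <= pow2sum u v k).
  { intro k. apply (CRle_trans _ (CRpow v k)); [apply CRpow_ge_zero, Hv|].
    apply pow2sum_bound; assumption. }
  destruct (alt_sum_bounds n (fun k => pow2sum u v k * invfact (2 * S k))) as [H1 H2].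
  - intro k. apply CRmult_le_0_compat; [apply Hp | apply invfact_nonneg].
  - intro k. apply (CRle_trans _ (CR_of_Q R 6 * pow2sum u v k * invfact (2 * S (S k)))).
    + apply CRmult_le_compat_r; [apply invfact_nonneg|]. apply pow2sum_bound; assumption.
    + assert (HI : CR_of_Q R 12 * invfact (2 * S (S k)) <= invfact (2 * S k)).
      { unfold invfact. rewrite <- CR_of_Q_mult. apply CR_of_Q_le.
        replace (2 * S (S k))%nat with (S (S (2 * S k))) by lia.
        assert (H0 := lt_O_fact (2 * S k)). revert H0.
        change (fact (S (S (2 * S k)))) with (S (S (2 * S k)) * (S (2 * S k) * fact (2 * S k)))%nat.
        generalize (fact (2 * S k)). intros f Hf.
        unfold Qle, Qmult; cbn [Qnum Qden].
        assert (12 * f <= S (S (2 * S k)) * (S (2 * S k) * f))%nat by nia.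
        lia. }
      apply (CRle_of_diff _ _ (pow2sum u v k * (invfact (2 * S k) - CR_of_Q R 12 * invfact (2 * S (S k)))
         * CR_of_Q R (1 # 2))).
      * apply CRmult_le_0_compat; [|apply CR_of_Q_le; discriminate].
        apply CRmult_le_0_compat; [apply Hp|]. apply CRle_sub, HI.
      * ring.
  - assert (E0 : pow2sum u v 0 * invfact (2 * 1) == CR_of_Q R (1 # 2)).
    { change (invfact (2 * 1)) with (CR_of_Q R (1 # 2)). simpl. ring. }
    assert (E1 : pow2sum u v 1 * invfact (2 * 2) == (u + v) * CR_of_Q R (1 # 24)).
    { change (invfact (2 * 2)) with (CR_of_Q R (1 # 24)). simpl. ring. }
    rewrite E0 in H1, H2. rewrite E1 in H2. split; assumption.
Qed.

Lemma cosq_cv : forall u, CR_cv R (fun n => CRsum (cosq_term u) (S n)) (cosq u).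
Proof.
  intro u. unfold cosq. destruct (cosq_exists u) as [l Hl]. simpl.
  apply (CR_cv_eq _ (fun n => CRsum (cosq_term u) (n + 1))).
  - intro n. rewrite Nat.add_1_r. reflexivity.
  - apply (CR_cv_shift' (CRsum (cosq_term u)) 1), Hl.
Qed.

Definition in03 (u : X) : Prop := 0 <= u /\ u <= CR_of_Q R 3.

Lemma cosq_diff_cv : forall u v,
  CR_cv R (fun n => (v - u) * cosq_slope u v n) (cosq u - cosq v).
Proof.
  intros u v.
  apply (CR_cv_eq _ (fun n => CRsum (cosq_term u) (S n) - CRsum (cosq_term v) (S n))).
  - intro n. apply cosq_sum_diff.
  - apply CR_cv_minus; apply cosq_cv.
Qed.

Lemma cosq_decr : forall u v, in03 u -> in03 v -> u <= v ->
  (v - u) * CR_of_Q R (1 # 4) <= cosq u - cosq v /\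
  cosq u - cosq v <= (v - u) * CR_of_Q R (1 # 2).
Proof.
  intros u v [Hu Hu3] [Hv Hv3] Huv. split.
  - apply (CR_cv_bound_down _ _ _ 0) with (2 := cosq_diff_cv u v). intros n _.
    apply CRmult_le_compat_l; [apply CRle_sub, Huv|].
    apply (CRle_trans _ _ _) with (2 := proj2 (cosq_slope_bounds u v n Hu Hu3 Hv Hv3)).
    apply (CRle_of_diff _ _ (((CR_of_Q R 3 - u) + (CR_of_Q R 3 - v)) * CR_of_Q R (1 # 24))); [|ring].
    apply CRmult_le_0_compat; [|apply CR_of_Q_le; discriminate].
    rewrite <- (CRplus_0_l 0). apply CRplus_le_compat; apply CRle_sub; assumption.
  - apply (CR_cv_bound_up _ _ _ 0) with (2 := cosq_diff_cv u v). intros n _.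
    apply CRmult_le_compat_l; [apply CRle_sub, Huv|].
    apply cosq_slope_bounds; assumption.
Qed.

Lemma cosq_0 : cosq 0 == 1.
Proof.
  unfold cosq. destruct (cosq_exists 0) as [l Hl]. simpl.
  apply (CR_cv_unique (CRsum (cosq_term 0))); [exact Hl|].
  apply (CR_cv_eq _ (fun _ => 1)); [|apply CR_cv_const].
  induction n as [|n IH].
  - unfold cosq_term, CRsgn. simpl. change (invfact 0) with (CR_of_Q R 1). ring.
  - cbn [CRsum]. rewrite <- IH. unfold cosq_term. cbn [CRpow]. ring.
Qed.

Lemma cosq_3 : cosq (CR_of_Q R 3) <= 0.
Proof.
  assert (H : CR_of_Q R 3 * CR_of_Q R (3 # 8) <= cosq 0 - cosq (CR_of_Q R 3)).
  { apply (CR_cv_bound_down _ _ _ 0) with (2 := cosq_diff_cv 0 (CR_of_Q R 3)). intros n _.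
    assert (E : CR_of_Q R 3 - 0 == CR_of_Q R 3) by ring. rewrite E.
    apply CRmult_le_compat_l; [apply CR_of_Q_le; discriminate|].
    apply (CRle_trans _ (CR_of_Q R (1 # 2) - (0 + CR_of_Q R 3) * CR_of_Q R (1 # 24))).
    - apply (CRle_of_diff _ _ 0); [apply CRle_refl | ring].
    - apply cosq_slope_bounds; try apply CRle_refl; apply CR_of_Q_le; discriminate. }
  rewrite cosq_0 in H.
  apply (CRle_of_diff _ _ ((1 - cosq (CR_of_Q R 3) - CR_of_Q R 3 * CR_of_Q R (3 # 8))
    + CR_of_Q R (1 # 8))); [|ring].
  rewrite <- (CRplus_0_l 0). apply CRplus_le_compat; [apply CRle_sub, H|].
  apply CR_of_Q_le. discriminate.
Qed.

(* A 1/2-contraction of [0,3] whose fixed point is the zero of [cosq]. *)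
Definition cosq_step (u : X) : X := u + CR_of_Q R 2 * cosq u.

Lemma cosq_step_mono : forall u v, in03 u -> in03 v -> u <= v ->
  cosq_step u <= cosq_step v.
Proof.
  intros u v Hu Hv Huv. unfold cosq_step.
  apply (CRle_of_diff _ _ (CR_of_Q R 2 * ((v - u) * CR_of_Q R (1 # 2) - (cosq u - cosq v)))); [|ring].
  apply CRmult_le_0_compat; [apply CR_of_Q_le; discriminate|].
  apply CRle_sub, cosq_decr; assumption.
Qed.

Lemma in03_0 : in03 0.
Proof. split; apply CR_of_Q_le; discriminate. Qed.

Lemma in03_3 : in03 (CR_of_Q R 3).
Proof. split; apply CR_of_Q_le; discriminate. Qed.

Lemma cosq_step_lb : forall u, in03 u -> CR_of_Q R 2 <= cosq_step u.
Proof.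
  intros u Hu. apply (CRle_trans _ (cosq_step 0)).
  - unfold cosq_step. rewrite cosq_0. apply (CRle_of_diff _ _ 0); [apply CRle_refl|ring].
  - apply cosq_step_mono; [apply in03_0 | exact Hu | apply Hu].
Qed.

Lemma cosq_step_in03 : forall u, in03 u -> in03 (cosq_step u).
Proof.
  intros u Hu. split.
  - apply (CRle_trans _ (CR_of_Q R 2)); [apply CR_of_Q_le; discriminate|].
    apply cosq_step_lb, Hu.
  - apply (CRle_trans _ (cosq_step (CR_of_Q R 3))).
    + apply cosq_step_mono; [exact Hu | apply in03_3 | apply Hu].
    + unfold cosq_step.
      apply (CRle_of_diff _ _ (CR_of_Q R 2 * (0 - cosq (CR_of_Q R 3)))); [|ring].
      apply CRmult_le_0_compat; [apply CR_of_Q_le; discriminate|].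
      apply CRle_sub, cosq_3.
Qed.

Lemma cosq_step_contract : forall u v, in03 u -> in03 v ->
  CRabs R (cosq_step u - cosq_step v) <= CRabs R (u - v) * CR_of_Q R (1 # 2).
Proof.
  intros u v [Hu Hu3] [Hv Hv3].
  assert (Hcv : CR_cv R (fun n => CRabs R ((u - v) + (v - u) * cosq_slope u v n * CR_of_Q R 2))
    (CRabs R (cosq_step u - cosq_step v))).
  { apply CR_cv_abs_cont.
    apply (CR_cv_proper _ ((u - v) + (cosq u - cosq v) * CR_of_Q R 2)).
    - apply CR_cv_plus; [apply CR_cv_const|]. apply CR_cv_scale, cosq_diff_cv.
    - unfold cosq_step. ring. }
  apply (CR_cv_bound_up _ _ _ 0) with (2 := Hcv). intros n _.
  assert (E : (u - v) + (v - u) * cosq_slope u v n * CR_of_Q R 2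
              == (u - v) * (1 - CR_of_Q R 2 * cosq_slope u v n)) by ring.
  rewrite E, CRabs_mult. apply CRmult_le_compat_l; [apply CRabs_pos|].
  destruct (cosq_slope_bounds u v n Hu Hu3 Hv Hv3) as [H1 H2].
  rewrite CRabs_right.
  - apply (CRle_of_diff _ _ (CR_of_Q R 2 * (cosq_slope u v n
      - (CR_of_Q R (1 # 2) - (u + v) * CR_of_Q R (1 # 24)))
      + ((CR_of_Q R 3 - u) + (CR_of_Q R 3 - v)) * CR_of_Q R (1 # 12))); [|ring].
    rewrite <- (CRplus_0_l 0). apply CRplus_le_compat.
    + apply CRmult_le_0_compat; [apply CR_of_Q_le; discriminate|]. apply CRle_sub, H2.
    + apply CRmult_le_0_compat; [|apply CR_of_Q_le; discriminate].
      rewrite <- (CRplus_0_l 0). apply CRplus_le_compat; apply CRle_sub; assumption.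
  - apply (CRle_of_diff _ _ (CR_of_Q R 2 * (CR_of_Q R (1 # 2) - cosq_slope u v n))); [|ring].
    apply CRmult_le_0_compat; [apply CR_of_Q_le; discriminate|]. apply CRle_sub, H1.
Qed.

Fixpoint cosq_iter (n : nat) : X :=
  match n with O => 0 | S n => cosq_step (cosq_iter n) end.

Lemma cosq_zero : { l : X | in03 l /\ CR_of_Q R 2 <= l /\ cosq l == 0 }.
Proof.
  assert (Hin : forall n, in03 (cosq_iter n)).
  { induction n; [apply in03_0|]. apply cosq_step_in03. assumption. }
  assert (Hd : forall n, CRabs R (cosq_iter (S n) - cosq_iter n)
      <= CRpow (CR_of_Q R (1 # 2)) n * CR_of_Q R 3).
  { induction n as [|n IH].
    - rewrite CRabs_right.
      + apply (CRle_of_diff _ _ (CR_of_Q R 3 - cosq_iter 1)).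
        * apply CRle_sub, (Hin 1%nat).
        * simpl. ring.
      + apply (CRle_of_diff _ _ (cosq_iter 1)); [apply (Hin 1%nat)|]. simpl. ring.
    - apply (CRle_trans _ _ _ (cosq_step_contract _ _ (Hin (S n)) (Hin n))).
      cbn [CRpow].
      apply (CRle_of_diff _ _ ((CRpow (CR_of_Q R (1 # 2)) n * CR_of_Q R 3
         - CRabs R (cosq_iter (S n) - cosq_iter n)) * CR_of_Q R (1 # 2))); [|ring].
      apply CRmult_le_0_compat; [|apply CR_of_Q_le; discriminate]. apply CRle_sub, IH. }
  destruct (series_cv_maj (fun n => cosq_iter (S n) - cosq_iter n) _ _ Hd
    (series_cv_scale (CR_of_Q R 3) _ _ GeoHalfTwo)) as [l [Hl _]].
  assert (Hcv : CR_cv R (fun n => cosq_iter (S n)) l).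
  { apply (CR_cv_eq _ (CRsum (fun n => cosq_iter (S n) - cosq_iter n))); [|exact Hl].
    induction n as [|n IH]; [simpl; ring|]. cbn [CRsum]. rewrite IH. ring. }
  assert (Hl03 : in03 l).
  { split.
    - apply (CR_cv_bound_down _ _ _ 0) with (2 := Hcv). intros n _. apply Hin.
    - apply (CR_cv_bound_up _ _ _ 0) with (2 := Hcv). intros n _. apply Hin. }
  exists l. split; [exact Hl03|].
  assert (Hfix : cosq_step l == l).
  { apply (CR_cv_unique (fun n => cosq_iter (S (S n)))).
    - intro p. destruct (Hcv p) as [N HN]. exists N. intros i Hi.
      apply (CRle_trans _ _ _ (cosq_step_contract _ _ (Hin (S i)) Hl03)).
      apply (CRle_trans _ (CRabs R (cosq_iter (S i) - l) * 1)).
      + apply CRmult_le_compat_l; [apply CRabs_pos|]. apply CR_of_Q_le. discriminate.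
      + rewrite CRmult_1_r. apply HN, Hi.
    - apply (CR_cv_eq _ (fun n => cosq_iter (S (n + 1)))).
      + intro n. rewrite Nat.add_1_r. reflexivity.
      + apply (CR_cv_shift' (fun n => cosq_iter (S n)) 1), Hcv. }
  split.
  - rewrite <- Hfix. apply cosq_step_lb, Hl03.
  - unfold cosq_step in Hfix.
    assert (E : cosq l == (l + CR_of_Q R 2 * cosq l - l) * CR_of_Q R (1 # 2)) by ring.
    rewrite E, Hfix. ring.
Qed.

Lemma cosq_proper : forall u v, u == v -> cosq u == cosq v.
Proof.
  intros u v H.
  assert (E : cosq u - cosq v == 0).
  { apply (CR_cv_unique (fun n => (v - u) * cosq_slope u v n)); [apply cosq_diff_cv|].
    apply (CR_cv_eq _ (fun _ => 0)); [|apply CR_cv_const].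
    intro n. generalize (cosq_slope u v n). intro d. rewrite H. ring. }
  assert (E' : cosq u == (cosq u - cosq v) + cosq v) by ring.
  rewrite E', E. ring.
Qed.

(* Characterizes pi: pi/2 is the least positive zero of the cosine. *)
Record is_pi (p : X) : Set := {
  is_pi_pos : 0 < p;
  is_pi_cos_half : CRcos (p * CR_of_Q R (1 # 2)) == 0;
  is_pi_cos_pos : forall t : X, 0 <= t -> t < p * CR_of_Q R (1 # 2) -> 0 < CRcos t
}.

Lemma CRpi_exists : { p : X & is_pi p }.
Proof.
  destruct cosq_zero as [l [[Hl0 Hl3] [Hl2 Hl]]].
  destruct (CRsqrt_exists l Hl0) as [r [Hr0 Hr]].
  exists (r * CR_of_Q R 2).
  assert (Hrp : 0 < r).
  { apply (CRmult_pos_pos r r); [|exact Hr0|exact Hr0]. rewrite Hr.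
    apply (CRlt_le_trans _ (CR_of_Q R 2)); [apply CR_of_Q_lt; reflexivity|exact Hl2]. }
  assert (Eh : r * CR_of_Q R 2 * CR_of_Q R (1 # 2) == r) by ring.
  constructor.
  - apply CRmult_lt_0_compat; [exact Hrp|]. apply CR_of_Q_lt. reflexivity.
  - rewrite CRcos_cosq, (cosq_proper _ l), Hl; [reflexivity|]. rewrite Eh. exact Hr.
  - intros t Ht0 Htr. rewrite Eh in Htr. rewrite CRcos_cosq.
    assert (Htl : t * t < l).
    { rewrite <- Hr. apply (CRle_lt_trans _ (r * t)).
      - apply CRmult_le_compat_r; [exact Ht0|]. apply CRlt_asym, Htr.
      - apply CRmult_lt_compat_l; assumption. }
    assert (Hle := CRlt_asym _ _ Htl).
    assert (Hlt : 0 < (l - t * t) * CR_of_Q R (1 # 4)).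
    { apply CRmult_lt_0_compat; [apply CRlt_minus, Htl|]. apply CR_of_Q_lt. reflexivity. }
    apply (CRlt_le_trans _ _ _ Hlt).
    assert (Hin : in03 (t * t)).
    { split; [apply CRsq_nonneg|]. apply (CRle_trans _ l); assumption. }
    assert (H := proj1 (cosq_decr (t * t) l Hin (conj Hl0 Hl3) Hle)).
    rewrite Hl in H. unfold CRminus in H at 2.
    rewrite CRopp_0, CRplus_0_r in H. exact H.
Qed.

Definition CRpi : X := projT1 CRpi_exists.
End RealLemmas.

Section Topology.
Context {R : ConstructiveReals}.
Notation X := (CRcarrier R).

(* A set with a distance; equality of points is distance 0.  Only the real
   line, the complex plane and their subsets occur, so the metric axioms are
   not made part of the structure. *)
Record space : Type := Space {
  point :> Type;
  dist : point -> point -> X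
}.
Arguments dist {s}.

Definition line : space := Space X (fun x y => CRabs R (x - y)).
Definition plane : space := Space complex (fun z w => Cabs (Cminus z w)).

Definition subspace {S : space} (A : S -> Type) : space :=
  Space { x : S & A x } (fun x y => dist (projT1 x) (projT1 y)).

Definition same {S : space} (x y : S) : Prop := dist x y == 0.
Definition apart {S : space} (x y : S) : Set := 0 < dist x y.

(* Membership in the image comes with a preimage; it is available to a function
   defined on [subspace (image f)], but such a function can only be uniformly
   continuous if its values do not depend on it. *)
Definition image {S T : space} (f : S -> T) : T -> Type :=
  fun y => { x : S & same y (f x) }.

Definition closure {S : space} (A : S -> Type) : S -> Type :=
  fun x => forall eps : X, 0 < eps -> { y : S & A y & dist x y < eps }.

Definition unif_cont {S T : space} (f : S -> T) : Type :=
  forall eps : X, 0 < eps ->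
  { delta : X & 0 < delta &
    forall x y : S, dist x y <= delta -> dist (f x) (f y) <= eps }.

Definition Cauchy (S : space) (x : nat -> S) : Type :=
  forall eps : X, 0 < eps ->
  { N : nat | forall m n, (N <= m)%nat -> (N <= n)%nat -> dist (x m) (x n) <= eps }.

Definition converges (S : space) (x : nat -> S) (l : S) : Type :=
  forall eps : X, 0 < eps ->
  { N : nat | forall n, (N <= n)%nat -> dist (x n) l <= eps }.

Definition complete (S : space) : Type :=
  forall x : nat -> S, Cauchy S x -> { l : S & converges S x l }.

Definition totally_bounded (S : space) : Type :=
  forall eps : X, 0 < eps ->
  { n : nat & { c : { i : nat | (i < n)%nat } -> S &
    forall x : S, { i : { i : nat | (i < n)%nat } & dist x (c i) < eps } } }.

Definition compact (S : space) : Type := (complete S * totally_bounded S)%type.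

(* The strong notion: distinct (apart) points have distinct images. *)
Definition injective {S T : space} (f : S -> T) : Type :=
  forall x y : S, apart x y -> apart (f x) (f y).

Definition onto {S T : space} (f : S -> T) : Type :=
  forall y : T, { x : S | same (f x) y }.

Definition unif_cont_inverse {S T : space} (f : S -> T) : Type :=
  { g : T -> S & unif_cont g &
    (forall x, same (g (f x)) x) /\ (forall y, same (f (g y)) y) }.

Record unif_bijection {S T : space} (f : S -> T) : Type := {
  ub_unif_cont : unif_cont f;
  ub_injective : injective f;
  ub_onto : onto f;
  ub_inverse : unif_cont_inverse f
}.

Definition interval (a b : X) : space := @subspace line (fun t : X => a <= t <= b).
Definition param {a b : X} (t : interval a b) : X := projT1 t.

Record is_path {a b : X} (gamma : interval a b -> plane) : Type := {
  path_lt : a < b;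
  path_unif_cont : unif_cont gamma
}.

Definition car {a b : X} (gamma : interval a b -> plane) : plane -> Type :=
  closure (image gamma).

Definition image_of {a b : X} (gamma : interval a b -> plane) (K : line -> Type) :
  plane -> Type :=
  fun z => { t : interval a b & K (param t) & same z (gamma t) }.

Record jordan_curve {a b : X} (gamma : interval a b -> plane) : Type := {
  jordan_path : is_path gamma;
  jordan_closed : forall s t : interval a b,
    param s == a -> param t == b -> same (gamma s) (gamma t);
  jordan_J1 : forall t t' : interval a b, a < param t' < b ->
    apart t t' -> apart (gamma t) (gamma t');
  jordan_J2 : forall K : line -> Type, (forall t, K t -> a < t < b) ->
    compact (subspace K) ->
    { g : subspace (image_of gamma K) -> subspace K & unif_cont g &
      forall (z : subspace (image_of gamma K)) (t : interval a b),
        K (param t) -> same (projT1 z) (gamma t) -> projT1 (g z) == param t }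
}.

Definition two_pi : X := CR_of_Q R 2 * CRpi.
Definition upsilon (t : interval 0 two_pi) : plane := cis (param t).
Definition unit_circle (z : plane) : Type := Cabs z == 1.
End Topology.

Arguments space R : clear implicits.

(* Main.v *)
(* Say that one parametrization on [0, 2pi] refines another when closeness of
   values of the first forces, uniformly, closeness of values of the second.
   The path [upsilon] refines every closed path: a short chord of the circle
   forces the arguments to be close or to lie near opposite ends.  So does a
   Jordan curve: on inner segments this is J2, and J2 makes the image of an inner
   segment complete, so that Bishop's lemma bounds it away from the endpoint
   [gamma 0].  Two parametrizations refining each other have uniformly equivalent
   ranges, and by completeness so are the closures of the ranges; the closure of
   the range of [upsilon] is the unit circle.  The addition formulas for cosine
   and sine follow from the principle that a function with increments O(h^2) is
   constant. *)
Require Import Defs.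
From Stdlib Require Import QArith Factorial PeanoNat Peano_dec Compare_dec ZArith Lia Ring.
From Stdlib Require Import ConstructiveReals ConstructiveAbs ConstructiveLimits
  ConstructiveSum ConstructivePower.
Local Open Scope ConstructiveReals.

Arguments dist {R s} _ _.

(** The obstacle is the base point. No parameter in [0, 2pi] can be assigned continuously to the
    points of the circle near 1, and constructively the circle is only the closure of the range of
    [upsilon]; so [F] cannot be defined by choosing an argument. [refines] compares two maps on a
    common parameter set without mentioning an inverse, and [follows] records what a map between the
    ranges or their closures must do. Well-definedness, uniform continuity, inverse and extension
    can all be read off from two [follows] facts in opposite directions. J1 gives pointwise
    apartness only, and J2 speaks of inner segments only. The missing ingredient is a positive
    distance between the values near the ends and those well inside, and Bishop's lemma supplies it.
    As a real cannot be compared with a cut point, end zones and inner segment always overlap and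
    cotransitivity picks a piece. *)

Ltac CR_const t :=
  match t with
  | CR_of_Q _ ?q => match isQcst q with true => q | _ => constr:(InitialRing.NotConstant) end
  | _ => constr:(InitialRing.NotConstant)
  end.

Section JordanCurves.
Context {R : ConstructiveReals}.
Notation X := (CRcarrier R).
Add Ring CRring : (@CR_ring_theory R)
  (morphism (@CR_Q_ring_morph R), setoid (CReq_rel (R:=R)) (CRisRingExt R), constants [CR_const]).

(** * Linear inequalities and small positive reals *)

Lemma CRplus_nonneg : forall x y : X, 0 <= x -> 0 <= y -> 0 <= x + y.
Proof.
  intros x y Hx Hy. rewrite <- (CRplus_0_l 0). apply CRplus_le_compat; assumption.
Qed.

Lemma CR_of_Q_nonneg : forall q, Qle_bool 0 q = true -> 0 <= CR_of_Q R q.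
Proof. intros q H. apply CR_of_Q_le, Qle_bool_iff, H. Qed.

Lemma CRscale_nonneg : forall q (x : X), 0 <= x -> Qle_bool 0 q = true -> 0 <= CR_of_Q R q * x.
Proof.
  intros q x Hx Hq. apply CRmult_le_0_compat; [apply CR_of_Q_nonneg, Hq | exact Hx].
Qed.

Lemma CRlt_sub_nonneg : forall a b : X, a < b -> 0 <= b - a.
Proof. intros a b H. apply CRle_sub, CRlt_asym, H. Qed.

Lemma CReq_le : forall a b : X, a == b -> a <= b.
Proof. intros a b H. rewrite H. apply CRle_refl. Qed.

Lemma CRcotrans : forall a b x : X, a < b -> (a < x) + (x < b).
Proof. intros a b x H. destruct (CRltLinear R) as [_ cotr]. apply cotr, H. Qed.

(* [lin t] proves [a <= b] by exhibiting [b - a] as a combination with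
   nonnegative rational coefficients of the inequalities listed in the tuple [t];
   an entry [(q, H)] stands for [q] times the inequality [H]. *)
Ltac gap t :=
  lazymatch type of t with
  | prod Q _ => lazymatch t with
      (?q, ?h) => let g := gap h in constr:(CRscale_nonneg q _ g eq_refl) end
  | prod _ _ => lazymatch t with
      (?s, ?h) => let g := gap s in let k := gap h in constr:(CRplus_nonneg _ _ g k) end
  | CRlt _ _ _ => constr:(CRlt_sub_nonneg _ _ t)
  | CReq _ _ _ => constr:(CRle_sub _ _ (CReq_le _ _ t))
  | _ => constr:(CRle_sub _ _ t)
  end.
Ltac lin t := let g := gap t in refine (CRle_of_diff _ _ _ g _); ring.

Lemma CRlt_of_diff : forall a b e : X, 0 < e -> b - a == e -> a < b.
Proof.
  intros a b e He H. apply (CRplus_lt_reg_r (- a)).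
  assert (H1 : a + - a == 0) by ring. rewrite H1.
  unfold CRminus in H. rewrite H. exact He.
Qed.

Lemma CRplus_pos_nonneg : forall x y : X, 0 < x -> 0 <= y -> 0 < x + y.
Proof.
  intros x y Hx Hy. apply (CRlt_le_trans _ x); [exact Hx|]. lin Hy.
Qed.

(** Strict counterpart of [lin]: the gap of the strict inequality [H], taken once, makes the whole
    combination positive. *)
Ltac slin H t :=
  let g := gap t in
  refine (CRlt_of_diff _ _ _ (CRplus_pos_nonneg _ _ (CRlt_minus _ _ H) g) _); ring.

Ltac pos := first
  [ assumption
  | apply CR_of_Q_lt; reflexivity
  | apply CRmult_lt_0_compat; pos ].

(* Nonstrict inequalities are negative statements, so they may be proved by a
   classical case distinction. *)
Lemma CRle_cases : forall a b u v : X,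
  (u <= v -> a <= b) -> (v <= u -> a <= b) -> a <= b.
Proof.
  intros a b u v H1 H2 H.
  assert (Huv : u <= v). { intro K. apply H2; [apply CRlt_asym, K | exact H]. }
  exact (H1 Huv H).
Qed.

Lemma CRle_all_pos : forall a b : X, (forall e, 0 < e -> a <= b + e) -> a <= b.
Proof.
  intros a b H Hlt.
  assert (H0 : 0 < (a - b) * CR_of_Q R (1#2)).
  { apply CRmult_lt_0_compat; [apply CRlt_minus, Hlt | pos]. }
  apply (H _ H0). slin H0 (CRle_refl b).
Qed.

Lemma CReq0_all_pos : forall a : X, 0 <= a -> (forall e, 0 < e -> a <= e) -> a == 0.
Proof.
  intros a H0 H. split; [exact H0|]. apply CRle_all_pos. intros e He.
  lin (H e He).
Qed.

(** Rationals squeezed below [a] and [b] can be compared decidably. *)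
Lemma CRmin_pos : forall a b : X, 0 < a -> 0 < b -> { c : X & 0 < c & c <= a /\ c <= b }.
Proof.
  intros a b Ha Hb.
  destruct (CR_Q_dense R 0 a Ha) as [p [Hp0 Hp]].
  destruct (CR_Q_dense R 0 b Hb) as [q [Hq0 Hq]].
  destruct (Qlt_le_dec p q) as [H|H].
  - exists (CR_of_Q R p); [exact Hp0|]. split; [apply CRlt_asym, Hp|].
    apply (CRle_trans _ (CR_of_Q R q)); [apply CR_of_Q_le, Qlt_le_weak, H | apply CRlt_asym, Hq].
  - exists (CR_of_Q R q); [exact Hq0|]. split; [|apply CRlt_asym, Hq].
    apply (CRle_trans _ (CR_of_Q R p)); [apply CR_of_Q_le, H | apply CRlt_asym, Hp].
Qed.

Definition shrink (n : nat) : X := CR_of_Q R (1 # Pos.of_nat (S n)).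

Lemma shrink_pos : forall n, 0 < shrink n.
Proof. intro n. apply CR_of_Q_lt. reflexivity. Qed.

Lemma shrink_le : forall m n, (m <= n)%nat -> shrink n <= shrink m.
Proof. intros m n H. apply CR_of_Q_le. unfold Qle; cbn [Qnum Qden]. lia. Qed.

Lemma shrink_small : forall e : X, 0 < e -> { n : nat & shrink n < e }.
Proof.
  intros e He. destruct (CR_Q_dense R 0 e He) as [[u d] [H0 H]].
  exists (Pos.to_nat d). apply (CRle_lt_trans _ (CR_of_Q R (u # d))); [|exact H].
  apply lt_CR_of_Q in H0. apply CR_of_Q_le. unfold Qlt, Qle in *. cbn [Qnum Qden] in *. nia.
Qed.

(** * Metric spaces, the line and the plane *)

(** A [space] carries no laws, so results about general spaces assume this predicate. *)
Record metric (S : space R) : Prop := {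
  dist_nonneg : forall x y : S, 0 <= dist x y;
  dist_refl : forall x : S, dist x x == 0;
  dist_sym : forall x y : S, dist x y == dist y x;
  dist_tri : forall x y z : S, dist x z <= dist x y + dist y z
}.

Lemma subspace_metric : forall (S : space R) (A : S -> Type), metric S -> metric (subspace A).
Proof.
  intros S A [H1 H2 H3 H4].
  constructor; intros; [apply H1 | apply H2 | apply H3 | apply H4].
Qed.

Lemma line_metric : metric (@line R).
Proof.
  constructor; intros; cbn.
  - apply CRabs_pos.
  - rewrite CRabs_right; [ring|]. lin (CRle_refl x).
  - apply CRabs_minus_sym.
  - assert (E : x - z == (x - y) + (y - z)) by ring. rewrite E. apply CRabs_triang.
Qed.

Lemma Cabs_nonneg : forall z : @complex R, 0 <= Cabs z.
Proof. intro z. unfold Cabs, CRsqrt. destruct CRsqrt_exists as [s Hs]. apply Hs. Qed.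

Lemma Cabs_sq : forall z : @complex R, Cabs z * Cabs z == Cre z * Cre z + Cim z * Cim z.
Proof. intro z. unfold Cabs, CRsqrt. destruct CRsqrt_exists as [s Hs]. apply Hs. Qed.

Lemma CRsq_inj : forall a b : X, 0 <= a -> 0 <= b -> a * a == b * b -> a == b.
Proof.
  intros a b Ha Hb H. split; apply CRsq_le_cancel; try assumption; rewrite H; apply CRle_refl.
Qed.

Lemma Cabs_le : forall (z : @complex R) m, 0 <= m ->
  Cre z * Cre z + Cim z * Cim z <= m * m -> Cabs z <= m.
Proof. intros z m Hm H. apply CRsq_le_cancel; [exact Hm|]. rewrite Cabs_sq. exact H. Qed.

Lemma plane_dist_sq : forall z w : @plane R,
  dist z w * dist z w ==
  (Cre z - Cre w) * (Cre z - Cre w) + (Cim z - Cim w) * (Cim z - Cim w).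
Proof. intros z w. apply (Cabs_sq (Cminus z w)). Qed.

Lemma plane_dist_le : forall (z w : @plane R) m, 0 <= m ->
  (Cre z - Cre w) * (Cre z - Cre w) + (Cim z - Cim w) * (Cim z - Cim w) <= m * m ->
  dist z w <= m.
Proof. intros z w m. apply (Cabs_le (Cminus z w)). Qed.

Lemma plane_metric : metric (@plane R).
Proof.
  assert (H0 : forall x y : @plane R, 0 <= dist x y) by (intros; apply Cabs_nonneg).
  constructor; [exact H0| | |].
  - intro x. apply CRsq_inj; [apply H0 | apply CRle_refl|]. rewrite plane_dist_sq. ring.
  - intros x y. apply CRsq_inj; [apply H0 | apply H0|]. rewrite !plane_dist_sq. ring.
  - intros x y z. assert (Hp := H0 x y). assert (Hq := H0 y z).
    assert (Ep := plane_dist_sq x y). assert (Eq := plane_dist_sq y z).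
    apply plane_dist_le; [apply CRplus_nonneg; assumption|].
    revert Hp Hq Ep Eq. generalize (dist x y), (dist y z). intros p q Hp Hq Ep Eq.
    set (a := Cre x - Cre y) in *. set (b := Cim x - Cim y) in *.
    set (c := Cre y - Cre z) in *. set (e := Cim y - Cim z) in *.
    assert (Ea : Cre x - Cre z == a + c) by (unfold a, c; ring).
    assert (Eb : Cim x - Cim z == b + e) by (unfold b, e; ring).
    rewrite Ea, Eb. clearbody a b c e.
    (* Cauchy-Schwarz *)
    assert (HC : a * c + b * e <= p * q).
    { apply CRsq_le_cancel; [apply CRmult_le_0_compat; assumption|].
      assert (E : p * q * (p * q) == (a * a + b * b) * (c * c + e * e)).
      { rewrite <- Ep, <- Eq. ring. }
      (* Lagrange's identity: the two squares differ by the square of [a * e - b * c]. *)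
      rewrite E. lin (CRsq_nonneg (a * e - b * c)). }
    assert (E : (p + q) * (p + q) == p * p + q * q + CR_of_Q R 2 * (p * q)) by ring.
    rewrite E, Ep, Eq. lin (2%Q, HC).
Qed.

Lemma CRabs_sq : forall x : X, CRabs R x * CRabs R x == x * x.
Proof. intro x. rewrite <- CRabs_mult. apply CRabs_right, CRsq_nonneg. Qed.

Lemma plane_dist_re : forall z w : @plane R, CRabs R (Cre z - Cre w) <= dist z w.
Proof.
  intros z w. apply CRsq_le_cancel; [apply (dist_nonneg _ plane_metric)|].
  rewrite plane_dist_sq, CRabs_sq. lin (CRsq_nonneg (Cim z - Cim w)).
Qed.

Lemma plane_dist_im : forall z w : @plane R, CRabs R (Cim z - Cim w) <= dist z w.
Proof.
  intros z w. apply CRsq_le_cancel; [apply (dist_nonneg _ plane_metric)|].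
  rewrite plane_dist_sq, CRabs_sq. lin (CRsq_nonneg (Cre z - Cre w)).
Qed.

Lemma plane_dist_le_sum : forall z w : @plane R,
  dist z w <= CRabs R (Cre z - Cre w) + CRabs R (Cim z - Cim w).
Proof.
  intros z w. apply plane_dist_le.
  - apply CRplus_nonneg; apply CRabs_pos.
  - rewrite <- (CRabs_sq (Cre z - Cre w)), <- (CRabs_sq (Cim z - Cim w)).
    lin (2%Q, CRmult_le_0_compat _ _ (CRabs_pos (Cre z - Cre w)) (CRabs_pos (Cim z - Cim w))).
Qed.

Lemma pos_fraction_lt : forall e : X, 0 < e -> { p : positive & CR_of_Q R (1 # p) < e }.
Proof.
  intros e He. destruct (shrink_small e He) as [n Hn]. exists (Pos.of_nat (S n)). exact Hn.
Qed.

Lemma line_complete : complete (@line R).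
Proof.
  intros x Hx. destruct (CR_complete R x) as [l Hl].
  - intro p. destruct (Hx (CR_of_Q R (1 # p))) as [N HN]; [pos|].
    exists N. intros i j Hi Hj. apply HN; assumption.
  - exists l. intros e He. destruct (pos_fraction_lt e He) as [p Hp].
    destruct (Hl p) as [N HN]. exists N. intros n Hn.
    apply (CRle_trans _ _ _ (HN n Hn)). apply CRlt_asym, Hp.
Qed.

Lemma plane_complete : complete (@plane R).
Proof.
  intros x Hx.
  destruct (line_complete (fun n => Cre (x n))) as [u Hu].
  { intros e He. destruct (Hx e He) as [N HN]. exists N. intros m n Hm Hn.
    apply (CRle_trans _ _ _ (plane_dist_re (x m) (x n))). apply HN; assumption. }
  destruct (line_complete (fun n => Cim (x n))) as [v Hv].
  { intros e He. destruct (Hx e He) as [N HN]. exists N. intros m n Hm Hn.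
    apply (CRle_trans _ _ _ (plane_dist_im (x m) (x n))). apply HN; assumption. }
  exists (u, v). intros e He.
  assert (He2 : 0 < e * CR_of_Q R (1#2)) by pos.
  destruct (Hu _ He2) as [N HN]. destruct (Hv _ He2) as [M HM].
  exists (Nat.max N M). intros n Hn.
  apply (CRle_trans _ _ _ (plane_dist_le_sum (x n) (u, v))).
  assert (H1 : CRabs R (Cre (x n) - u) <= e * CR_of_Q R (1#2)) by (apply HN; lia).
  assert (H2 : CRabs R (Cim (x n) - v) <= e * CR_of_Q R (1#2)) by (apply HM; lia).
  change (CRabs R (Cre (x n) - u) + CRabs R (Cim (x n) - v) <= e).
  lin (H1, H2).
Qed.

(** * Extension of correspondences to closures *)

Definition refines {P : Type} {S T : space R} (alpha : P -> S) (beta : P -> T) : Type :=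
  forall eps : X, 0 < eps ->
  { delta : X & 0 < delta &
    forall p q : P, dist (alpha p) (alpha q) <= delta -> dist (beta p) (beta q) <= eps }.

(* [F] maps points near [alpha p] to points near [beta p]; when [A] lies in the
   closure of the range of [alpha], this determines [F]. *)
Definition follows {P : Type} {S T : space R} (alpha : P -> S) (beta : P -> T)
  {A : S -> Type} {B : T -> Type} (F : subspace A -> subspace B) : Type :=
  forall eps : X, 0 < eps ->
  { delta : X & 0 < delta &
    forall (x : subspace A) (p : P),
      dist (projT1 x) (alpha p) <= delta -> dist (projT1 (F x)) (beta p) <= eps }.

Lemma half_pos : forall e : X, 0 < e -> 0 < e * CR_of_Q R (1#2).
Proof.
  intros e He. apply CRmult_lt_0_compat; [exact He | apply CR_of_Q_lt; reflexivity].
Qed.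

Lemma closure_image_point : forall {P : space R} {S : space R}, metric S ->
  forall (alpha : P -> S) x, closure (image alpha) x ->
  forall e : X, 0 < e -> { p : P & dist x (alpha p) <= e }.
Proof.
  intros P S HS alpha x Hx e He. destruct (Hx e He) as [y [p Hp] Hy]. exists p.
  apply (CRle_trans _ _ _ (dist_tri _ HS x y (alpha p))). lin (Hy, proj2 Hp).
Qed.

Lemma image_closure : forall {S : space R}, metric S ->
  forall (A : S -> Type) x, A x -> closure A x.
Proof.
  intros S HS A x Hx e He. exists x; [exact Hx|]. rewrite (dist_refl _ HS). exact He.
Qed.

(** One parameter [p] with [alpha p] close to both points puts both values close to [beta p].
    Allowing two domains makes this the proof that [F] extends [f]. *)
Lemma follows_compatible : forall {P S T : space R}, metric S -> metric T ->
  forall (alpha : P -> S) (beta : P -> T) (A A' : S -> Type) (B B' : T -> Type)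
    (F : subspace A -> subspace B) (F' : subspace A' -> subspace B'),
  (forall x, A x -> closure (image alpha) x) ->
  follows alpha beta F -> follows alpha beta F' ->
  forall x x', same (projT1 x) (projT1 x') -> same (projT1 (F x)) (projT1 (F' x')).
Proof.
  intros P S T HS HT alpha beta A A' B B' F F' HA HF HF' x x' Hxx.
  apply CReq0_all_pos; [apply (dist_nonneg _ HT)|]. intros e He.
  destruct (HF _ (half_pos e He)) as [d Hd H]. destruct (HF' _ (half_pos e He)) as [d' Hd' H'].
  destruct (CRmin_pos d d' Hd Hd') as [c Hc [Hcd Hcd']].
  destruct (closure_image_point HS alpha _ (HA _ (projT2 x)) c Hc) as [p Hp].
  assert (H1 : dist (projT1 x) (alpha p) <= d) by lin (Hp, Hcd).
  assert (H2 : dist (projT1 x') (alpha p) <= d').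
  { apply (CRle_trans _ _ _ (dist_tri _ HS _ (projT1 x) _)).
    rewrite (dist_sym _ HS (projT1 x')). lin (Hp, Hcd', proj2 Hxx). }
  apply (CRle_trans _ _ _ (dist_tri _ HT _ (beta p) _)).
  rewrite (dist_sym _ HT (beta p)). lin (H x p H1, H' x' p H2).
Qed.

Lemma follows_unif_bijection : forall {P S T : space R}, metric S -> metric T ->
  forall (alpha : P -> S) (beta : P -> T) (A : S -> Type) (B : T -> Type)
    (F : subspace A -> subspace B) (G : subspace B -> subspace A),
  (forall x, A x -> closure (image alpha) x) ->
  (forall y, B y -> closure (image beta) y) ->
  follows alpha beta F -> follows beta alpha G -> unif_bijection F.
Proof.
  (* Generic in the spaces, since it is applied to [F] and, with the roles exchanged, to [G]. *)
  assert (UC : forall {P S T : space R}, metric S -> metric T ->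
    forall (alpha : P -> S) (beta : P -> T) (A : S -> Type) (B : T -> Type)
      (F : subspace A -> subspace B),
    (forall x, A x -> closure (image alpha) x) -> follows alpha beta F -> unif_cont F).
  { intros P S T HS HT alpha beta A B F HA HF e He.
    destruct (HF _ (half_pos e He)) as [d Hd H].
    exists (d * CR_of_Q R (1#2)); [apply half_pos, Hd|]. intros x y Hxy.
    destruct (closure_image_point HS alpha _ (HA _ (projT2 x)) _ (half_pos d Hd)) as [p Hp].
    assert (H1 : dist (projT1 x) (alpha p) <= d).
    { apply (CRle_trans _ _ _ Hp). lin ((1#2)%Q, Hd). }
    assert (H2 : dist (projT1 y) (alpha p) <= d).
    { apply (CRle_trans _ _ _ (dist_tri _ HS _ (projT1 x) _)).
      rewrite (dist_sym _ HS (projT1 y)).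
      change (dist x y) with (dist (projT1 x) (projT1 y)) in Hxy. lin (Hp, Hxy). }
    apply (CRle_trans _ _ _ (dist_tri _ HT _ (beta p) _)).
    change (dist (projT1 (F x)) (beta p) + dist (beta p) (projT1 (F y)) <= e).
    rewrite (dist_sym _ HT (beta p)). lin (H x p H1, H y p H2). }
  assert (Inv : forall {P S T : space R}, metric S ->
    forall (alpha : P -> S) (beta : P -> T) (A : S -> Type) (B : T -> Type)
      (F : subspace A -> subspace B) (G : subspace B -> subspace A),
    (forall x, A x -> closure (image alpha) x) ->
    follows alpha beta F -> follows beta alpha G -> forall x, same (G (F x)) x).
  { intros P S T HS alpha beta A B F G HA HF HG x.
    apply CReq0_all_pos; [apply (dist_nonneg _ HS)|]. intros e He.
    destruct (HG _ (half_pos e He)) as [d Hd H]. destruct (HF _ Hd) as [c Hc K].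
    destruct (CRmin_pos c _ Hc (half_pos e He)) as [b Hb [Hbc Hbe]].
    destruct (closure_image_point HS alpha _ (HA _ (projT2 x)) b Hb) as [p Hp].
    assert (H1 : dist (projT1 x) (alpha p) <= c) by lin (Hp, Hbc).
    apply (CRle_trans _ _ _ (dist_tri _ HS _ (alpha p) _)).
    rewrite (dist_sym _ HS (alpha p)). lin (H (F x) p (K x p H1), Hp, Hbe). }
  intros P S T HS HT alpha beta A B F G HA HB HF HG.
  assert (UF := UC P S T HS HT alpha beta A B F HA HF).
  assert (UG := UC P T S HT HS beta alpha B A G HB HG).
  assert (GF := Inv P S T HS alpha beta A B F G HA HF HG).
  assert (FG := Inv P T S HT beta alpha B A G F HB HG HF).
  constructor.
  - exact UF.
  - intros x y Hxy.
    (* Strong injectivity: either the images are apart, or they are so close that [G] brings [x] and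
       [y] within half of their own distance. *)
    destruct (UG _ (half_pos _ Hxy)) as [d Hd H].
    destruct (CRcotrans 0 d (dist (F x) (F y)) Hd) as [K|K]; [exact K|]. exfalso.
    assert (H1 := H _ _ (CRlt_asym _ _ K)).
    assert (H2 : dist x y <= dist (G (F x)) (G (F y))).
    { apply (CRle_trans _ _ _ (dist_tri _ HS _ (projT1 (G (F x))) _)).
      assert (E1 := GF x). assert (E2 := GF y). unfold same in E1, E2. cbn in E1, E2 |- *.
      rewrite (dist_sym _ HS (projT1 x)).
      apply (CRle_trans _ (dist (projT1 (G (F x))) (projT1 x) +
        (dist (projT1 (G (F x))) (projT1 (G (F y))) + dist (projT1 (G (F y))) (projT1 y)))).
      - apply CRplus_le_compat_l, (dist_tri _ HS).
      - rewrite E1, E2. apply CReq_le. ring. }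
    revert H1 H2 Hxy. unfold apart. generalize (dist x y), (dist (G (F x)) (G (F y))).
    intros u v H1 H2 Hu.
    assert (K0 : u <= 0) by lin ((2%Q, H1), (2%Q, H2)). exact (K0 Hu).
  - intro y. exists (G y). apply FG.
  - exists G; [exact UG|]. split; assumption.
Qed.

(** [F x] is the limit of [beta] along parameters whose [alpha] values tend to [x]; refinement makes
    that sequence Cauchy. *)
Lemma closure_extension : forall {P S T : space R}, metric S -> metric T -> complete T ->
  forall (alpha : P -> S) (beta : P -> T), refines alpha beta ->
  forall (A : S -> Type) (B : T -> Type),
  (forall x, A x -> closure (image alpha) x) ->
  (forall y, closure (image beta) y -> B y) ->
  { F : subspace A -> subspace B & follows alpha beta F }.
Proof.
  intros P S T HS HT CT alpha beta HR A B HA HB.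
  (* Membership in a closure carries its witnesses, so the approximating sequence is obtained
     without a choice principle. *)
  pose (pt := fun (x : subspace A) n =>
    projT1 (closure_image_point HS alpha _ (HA _ (projT2 x)) _ (shrink_pos n))).
  assert (Hpt : forall x n, dist (projT1 x) (alpha (pt x n)) <= shrink n).
  { intros x n. unfold pt. destruct closure_image_point as [p Hp]. exact Hp. }
  clearbody pt.
  assert (Hc : forall x, Cauchy T (fun n => beta (pt x n))).
  { intros x e He. destruct (HR e He) as [d Hd H].
    destruct (shrink_small _ (half_pos d Hd)) as [N HN]. exists N. intros m n Hm Hn.
    apply H. apply (CRle_trans _ _ _ (dist_tri _ HS _ (projT1 x) _)).
    rewrite (dist_sym _ HS (alpha _)).
    assert (H1 := Hpt x m). assert (H2 := Hpt x n).
    assert (H3 := shrink_le N m Hm). assert (H4 := shrink_le N n Hn).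
    lin (H1, H2, H3, H4, (2%Q, HN)). }
  pose (lim := fun x => projT1 (CT _ (Hc x))).
  assert (Hlim : forall x, converges T (fun n => beta (pt x n)) (lim x)).
  { intro x. unfold lim. destruct (CT _ (Hc x)) as [l Hl]. exact Hl. }
  clearbody lim.
  assert (Hcl : forall x, closure (image beta) (lim x)).
  { intros x e He. destruct (Hlim x _ (half_pos e He)) as [N HN].
    exists (beta (pt x N)).
    - exists (pt x N). apply (dist_refl _ HT).
    - rewrite (dist_sym _ HT). apply (CRle_lt_trans _ _ _ (HN N (le_n N))).
      apply (CRlt_of_diff _ _ _ (half_pos e He)). ring. }
  exists (fun x => existT _ (lim x) (HB _ (Hcl x))).
  intros e He. destruct (HR _ (half_pos e He)) as [d Hd H].
  exists (d * CR_of_Q R (1#2)); [apply half_pos, Hd|].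
  intros x p Hp. cbn [projT1].
  destruct (shrink_small _ (half_pos d Hd)) as [N HN].
  destruct (Hlim x _ (half_pos e He)) as [M HM].
  assert (K1 := HM (Nat.max N M) (Nat.le_max_r _ _)). cbn beta in K1.
  assert (K2 := Hpt x (Nat.max N M)).
  assert (K3 := shrink_le N _ (Nat.le_max_l N M)).
  apply (CRle_trans _ _ _ (dist_tri _ HT _ (beta (pt x (Nat.max N M))) _)).
  rewrite (dist_sym _ HT (lim x)).
  assert (K4 : dist (alpha (pt x (Nat.max N M))) (alpha p) <= d).
  { apply (CRle_trans _ _ _ (dist_tri _ HS _ (projT1 x) _)).
    rewrite (dist_sym _ HS (alpha _)). lin (Hp, K2, K3, HN). }
  lin (K1, H _ _ K4).
Qed.

(** The value is computed from the parameter packed in the membership witness; under refinement,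
    [image_map_follows] implies that another parameter of the same point gives the same value. *)
Definition image_map {P S T : space R} (HT : metric T) (alpha : P -> S) (beta : P -> T)
  (x : subspace (image alpha)) : subspace (image beta) :=
  existT _ (beta (projT1 (projT2 x)))
    (existT _ (projT1 (projT2 x)) (dist_refl _ HT (beta (projT1 (projT2 x))))).

Lemma image_map_follows : forall {P S T : space R} (HS : metric S) (HT : metric T)
  (alpha : P -> S) (beta : P -> T), refines alpha beta ->
  follows alpha beta (image_map HT alpha beta).
Proof.
  intros P S T HS HT alpha beta HR e He. destruct (HR e He) as [d Hd H].
  exists d; [exact Hd|]. intros [x [q Hq]] p Hp. cbn in Hp |- *. apply H.
  apply (CRle_trans _ _ _ (dist_tri _ HS _ x _)). rewrite (dist_sym _ HS (alpha q)).
  lin (Hp, proj2 Hq).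
Qed.

(** * Bishop's lemma *)

Lemma finite_choice : forall (n : nat) (P Q : { i : nat | (i < n)%nat } -> Type),
  (forall i, P i + Q i) -> { i & P i } + (forall i, Q i).
Proof.
  induction n as [|n IH]; intros P Q H.
  - right. intros [i Hi]. exfalso. lia.
  - pose (emb := fun i : { i : nat | (i < n)%nat } =>
      exist (fun i => (i < S n)%nat) (proj1_sig i) (le_S _ _ (proj2_sig i))).
    pose (top := exist (fun i => (i < S n)%nat) n (le_n (S n))).
    destruct (IH (fun i => P (emb i)) (fun i => Q (emb i)) (fun i => H (emb i))) as [[i Hi]|Hq].
    + left. exists (emb i). exact Hi.
    + destruct (H top) as [Hp|Ht]; [left; exists top; exact Hp|]. right.
      intros [i Hi]. destruct (le_lt_eq_dec i n (proj1 (Nat.lt_succ_r i n) Hi)) as [Hl|He].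
      * assert (K := Hq (exist _ i Hl)). unfold emb in K. cbn in K.
        (* An index contains a proof of [i < S n]; uniqueness of such proofs identifies the two
           indices. *)
        rewrite (le_unique _ _ (le_S _ _ Hl) Hi) in K. exact K.
      * subst i. unfold top in Ht. rewrite (le_unique _ _ (le_n (S n)) Hi) in Ht. exact Ht.
Qed.

(* Bishop's lemma for the range of a map with uniformly continuous inverse.  The
   sequence below follows ever better approximations of [p] as long as they can
   be found and is constant afterwards, hence Cauchy; its limit is apart from
   [p], so the search for approximations must have failed at some stage. *)
Lemma bounded_away : forall {Y T : space R}, metric Y -> metric T ->
  compact Y -> forall (Phi : Y -> T), unif_cont Phi ->
  refines Phi (fun x : Y => x) ->
  forall p : T, (forall x, apart p (Phi x)) ->
  { r : X & 0 < r & forall x, r <= dist p (Phi x) }.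
Proof.
  intros Y T HY HT [CY TB] Phi HPhi Hinv p Hp.
  set (Bound := { r : X & 0 < r & forall x, r <= dist p (Phi x) }).
  (* Test each point of a finite net against [e / 2] and [e]. If all are far, the modulus of [Phi]
     for [e / 4] leaves the bound [e / 4] at every point. *)
  assert (dec : forall e : X, 0 < e -> { x : Y & dist p (Phi x) <= e } + Bound).
  { intros e He.
    destruct (HPhi _ (half_pos _ (half_pos e He))) as [d Hd H].
    destruct (TB d Hd) as [n [c Hc]].
    destruct (finite_choice n (fun i => dist p (Phi (c i)) < e)
      (fun i => e * CR_of_Q R (1#2) < dist p (Phi (c i)))) as [[i Hi]|Hfar].
    - intro i. destruct (CRcotrans (e * CR_of_Q R (1#2)) e (dist p (Phi (c i)))) as [K|K].
      + apply (CRlt_of_diff _ _ _ (half_pos e He)). ring.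
      + right. exact K.
      + left. exact K.
    - left. exists (c i). apply CRlt_asym, Hi.
    - right. exists (e * CR_of_Q R (1#2) * CR_of_Q R (1#2)).
      + apply half_pos, half_pos, He.
      + intro x. destruct (Hc x) as [i Hi].
        assert (K1 := H x (c i) (CRlt_asym _ _ Hi)). assert (K2 := Hfar i).
        assert (K3 := dist_tri _ HT p (Phi x) (Phi (c i))). lin (K1, K2, K3). }
  destruct (dec _ (shrink_pos O)) as [[x0 Hx0]|b]; [|exact b].
  (* A stage is alive ([inl]) while the search succeeds; once a bound is found ([inr]) the point is
     frozen. *)
  pose (st := fix st (n : nat) : { x : Y & (dist p (Phi x) <= shrink n) + Bound }%type :=
    match n with
    | O => existT _ x0 (inl Hx0)
    | S m => match st m with
        | existT _ x (inr b) => existT _ x (inr b)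
        | existT _ x (inl _) => match dec _ (shrink_pos (S m)) with
            | inl (existT _ w Hw) => existT _ w (inl Hw)
            | inr b => existT _ x (inr b)
            end
        end
    end).
  assert (stS : forall n, match projT2 (st n) with
      | inl _ => True
      | inr _ => (if projT2 (st (S n)) then False else True) /\ projT1 (st (S n)) = projT1 (st n)
      end).
  { intro n. cbn [st]. fold st. destruct (st n) as [x [Hx|b]]; cbn; [exact I|]. split; reflexivity. }
  assert (dead : forall n k, match projT2 (st n) with
      | inl _ => True
      | inr _ => (if projT2 (st (k + n)%nat) then False else True)
                 /\ projT1 (st (k + n)%nat) = projT1 (st n)
      end).
  { intros n k. induction k as [|k IH].
    - cbn. destruct (projT2 (st n)); [exact I|]. split; [exact I|reflexivity].
    - assert (K := stS (k + n)%nat). change (S k + n)%nat with (S (k + n)).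
      destruct (projT2 (st n)); [exact I|]. destruct IH as [I1 I2].
      destruct (projT2 (st (k + n)%nat)); [contradiction|].
      destruct K as [K1 K2]. split; [exact K1|]. rewrite K2. exact I2. }
  (* A point frozen after stage [n] is still the last good approximation, so the estimate of an
     alive stage persists. *)
  assert (near : forall n k, (if projT2 (st n) then True else False) ->
      dist p (Phi (projT1 (st (k + n)%nat))) <= shrink n).
  { intros n k Hn. induction k as [|k IH].
    - cbn. destruct (st n) as [x [Hx|b]]; [exact Hx|contradiction].
    - change (S k + n)%nat with (S (k + n)).
      cbn [st]. fold st. destruct (st (k + n)%nat) as [x [Hx|b]]; cbn in IH |- *; [|exact IH].
      destruct (dec _ _) as [[w Hw]|b]; cbn; [|exact IH].
      apply (CRle_trans _ _ _ Hw). apply shrink_le. lia. }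
  clearbody st. clear stS.
  destruct (CY (fun n => projT1 (st n))) as [l Hl].
  { intros e He. destruct (Hinv e He) as [d Hd H].
    destruct (shrink_small _ (half_pos d Hd)) as [N HN]. exists N. intros m n Hm Hn. apply H.
    replace m with ((m - N) + N)%nat by lia. replace n with ((n - N) + N)%nat by lia.
    generalize (m - N)%nat, (n - N)%nat. clear m n Hm Hn. intros i j.
    assert (D1 := dead N i). assert (D2 := dead N j).
    assert (N1 := near N i). assert (N2 := near N j).
    destruct (projT2 (st N)).
    - apply (CRle_trans _ _ _ (dist_tri _ HT _ p _)). rewrite (dist_sym _ HT _ p).
      lin (N1 I, N2 I, (2%Q, HN)).
    - destruct D1 as [_ D1], D2 as [_ D2]. rewrite D1, D2, (dist_refl _ HT).
      apply CRlt_asym, Hd. }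
  assert (Hpl := Hp l). unfold apart in Hpl.
  destruct (shrink_small _ (half_pos _ Hpl)) as [N HN].
  (* With D the distance from [p] to [Phi l], an alive stage [N] would give D <= D/2 + D/4. *)
  destruct (projT2 (st N)) as [Halive|b] eqn:E; [exfalso | exact b].
  destruct (HPhi _ (half_pos _ (half_pos _ Hpl))) as [d Hd H].
  destruct (Hl d Hd) as [M HM].
  assert (K1 := H _ _ (HM (M + N)%nat (Nat.le_add_r M N))).
  assert (K2 := near N M). rewrite E in K2. specialize (K2 I).
  assert (K3 := dist_tri _ HT p (Phi (projT1 (st (M + N)%nat))) (Phi l)).
  assert (K : dist p (Phi l) <= 0) by lin ((4%Q, HN), (4%Q, K1), (4%Q, K2), (4%Q, K3)).
  exact (K Hpl).
Qed.

Definition segment (c d : X) : @line R -> Type := fun t => c <= t <= d.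

(** Search downward from a grid point above [x]. Cotransitivity needs a gap of one step below the
    next grid point, which is why the error is [2 * h] and not [h]. *)
Lemma segment_net : forall (c h x : X), 0 < h -> c <= x -> forall m : nat,
  x <= c + CR_of_Q R (Z.of_nat m # 1) * h ->
  { i : nat | (i <= m)%nat & CRabs R (x - (c + CR_of_Q R (Z.of_nat i # 1) * h)) <= CR_of_Q R 2 * h }.
Proof.
  intros c h x Hh Hc. induction m as [|m IH]; intro Hm.
  - exists O; [lia|]. apply CRabs_le. cbn [Z.of_nat] in *. split; [lin (Hc, (2%Q, Hh)) | lin (Hm, (2%Q, Hh))].
  - assert (E : CR_of_Q R (Z.of_nat (S m) # 1) == CR_of_Q R (Z.of_nat m # 1) + 1).
    { rewrite <- CR_of_Q_plus. apply CR_of_Q_morph. unfold Qeq, Qplus; cbn [Qnum Qden]. lia. }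
    rewrite E in Hm.
    destruct (CRcotrans (c + CR_of_Q R (Z.of_nat m # 1) * h - h) (c + CR_of_Q R (Z.of_nat m # 1) * h) x)
      as [H|H].
    + apply (CRlt_of_diff _ _ _ Hh). ring.
    + exists (S m); [lia|]. rewrite E. apply CRabs_le. split.
      * lin H.
      * lin (Hm, (2%Q, Hh)).
    + destruct (IH (CRlt_asym _ _ H)) as [i Hi K]. exists i; [lia|exact K].
Qed.

Lemma segment_compact : forall c d : X, c < d -> compact (subspace (segment c d)).
Proof.
  intros c d Hcd. split.
  - intros x Hx. destruct (line_complete (fun n => projT1 (x n)) Hx) as [l Hl].
    assert (Hin : c <= l <= d).
    { split; apply CRle_all_pos; intros e He; destruct (Hl e He) as [N HN];
        assert (K := HN N (le_n N)); destruct (projT2 (x N)) as [K1 K2];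
        apply CRabs_def2 in K; destruct K as [K3 K4].
      - lin (K1, K3).
      - lin (K2, K4). }
    exists (existT _ l Hin). exact Hl.
  - intros e He.
    (* [n] exceeds [4 * (d - c) / e], so the mesh [h] satisfies [4 * h < e]; the net error is
       [2 * h]. *)
    destruct (CR_archimedean R (CRinv R e (inr He) * (d - c) * CR_of_Q R 4)) as [n Hn].
    assert (Hinv := CRinv_l R e (inr He)). revert Hn Hinv. generalize (CRinv R e (inr He)).
    intros v Hn Hinv.
    set (h := (d - c) * CR_of_Q R (1 # n)).
    assert (Hh : 0 < h).
    { apply CRmult_lt_0_compat; [apply CRlt_minus, Hcd | apply CR_of_Q_lt; reflexivity]. }
    assert (En : CR_of_Q R (Z.pos n # 1) * CR_of_Q R (1 # n) == 1).
    { rewrite <- CR_of_Q_mult. apply CR_of_Q_morph. unfold Qeq, Qmult; cbn [Qnum Qden]. lia. }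
    assert (Hhe : CR_of_Q R 4 * h < e).
    { assert (K := CRmult_lt_compat_r (e * CR_of_Q R (1 # n)) _ _
        (CRmult_lt_0_compat _ _ _ He (CR_of_Q_lt R 0 (1 # n) eq_refl)) Hn).
      apply (CRlt_of_diff _ _ _ (CRlt_minus _ _ K)).
      assert (E1 : v * (d - c) * CR_of_Q R 4 * (e * CR_of_Q R (1 # n)) == v * e * (CR_of_Q R 4 * h)).
      { unfold h. ring. }
      assert (E2 : CR_of_Q R (Z.pos n # 1) * (e * CR_of_Q R (1 # n))
        == e * (CR_of_Q R (Z.pos n # 1) * CR_of_Q R (1 # n))) by ring.
      rewrite E1, E2, Hinv, En. ring. }
    assert (Ed : d == c + CR_of_Q R (Z.of_nat (Pos.to_nat n) # 1) * h).
    { rewrite positive_nat_Z. unfold h.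
      assert (E2 : c + CR_of_Q R (Z.pos n # 1) * ((d - c) * CR_of_Q R (1 # n))
        == c + (d - c) * (CR_of_Q R (Z.pos n # 1) * CR_of_Q R (1 # n))) by ring.
      rewrite E2, En. ring. }
    clearbody h. clear En Hn Hinv v.
    assert (Hin : forall i, (i < S (Pos.to_nat n))%nat ->
      c <= c + CR_of_Q R (Z.of_nat i # 1) * h <= d).
    { intros i Hi. split.
      - assert (K : 0 <= CR_of_Q R (Z.of_nat i # 1) * h).
        { apply CRmult_le_0_compat; [|apply CRlt_asym, Hh]. apply CR_of_Q_le.
          unfold Qle; cbn [Qnum Qden]. lia. }
        lin K.
      - rewrite Ed at 1. apply CRplus_le_compat_l.
        apply CRmult_le_compat_r; [apply CRlt_asym, Hh|]. apply CR_of_Q_le.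
        unfold Qle; cbn [Qnum Qden]. lia. }
    exists (S (Pos.to_nat n)).
    exists (fun i => existT _ (c + CR_of_Q R (Z.of_nat (proj1_sig i) # 1) * h)
                       (Hin _ (proj2_sig i))).
    intros [x [Hxc Hxd]]. assert (Hxn := Hxd). rewrite Ed in Hxn at 1.
    destruct (segment_net c h x Hh Hxc _ Hxn) as [i Hi K].
    exists (exist _ i (proj2 (Nat.lt_succ_r _ _) Hi)). cbn.
    apply (CRle_lt_trans _ _ _ K). apply (CRle_lt_trans _ (CR_of_Q R 4 * h)); [|exact Hhe].
    lin (2%Q, Hh).
Qed.

(** * Jordan curves *)

Lemma unif_cont_same : forall {S T : space R}, metric T -> forall f : S -> T,
  unif_cont f -> forall x y, same x y -> same (f x) (f y).
Proof.
  intros S T HT f Hf x y H. apply CReq0_all_pos; [apply (dist_nonneg _ HT)|].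
  intros e He. destruct (Hf e He) as [d Hd K]. apply K. unfold same in H. rewrite H.
  apply CRlt_asym, Hd.
Qed.

Definition left_end {a b : X} (H : a <= b) : interval a b := existT _ a (conj (CRle_refl a) H).
Definition right_end {a b : X} (H : a <= b) : interval a b := existT _ b (conj H (CRle_refl b)).

Definition near_end {a b : X} (w : X) (t : interval a b) : Type :=
  sum (param t <= a + w) (b - w <= param t).

(** Zones of width [w] overlap the segment that begins at [w / 2]; the overlap is what makes the
    alternative decidable. *)
Lemma near_end_or_inner : forall {a b : X} (w : X), 0 < w -> forall t : interval a b,
  near_end w t + segment (a + w * CR_of_Q R (1#2)) (b - w * CR_of_Q R (1#2)) (param t).
Proof.
  intros a b w Hw t. assert (Hw2 := half_pos w Hw).
  destruct (CRcotrans (a + w * CR_of_Q R (1#2)) (a + w) (param t)) as [H1|H1].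
  - apply (CRlt_of_diff _ _ _ Hw2). ring.
  - destruct (CRcotrans (b - w) (b - w * CR_of_Q R (1#2)) (param t)) as [H2|H2].
    + apply (CRlt_of_diff _ _ _ Hw2). ring.
    + left. right. apply CRlt_asym, H2.
    + right. split; apply CRlt_asym; assumption.
  - left. left. apply CRlt_asym, H1.
Qed.

(** As [f] is closed, the left end serves as base point for both end zones. *)
Lemma near_end_dist : forall {a b : X} (H : a <= b) {T : space R}, metric T ->
  forall f : interval a b -> T, same (f (left_end H)) (f (right_end H)) ->
  forall w e : X, 0 <= e -> (forall s t, dist s t <= w -> dist (f s) (f t) <= e) ->
  forall t, near_end w t -> dist (f (left_end H)) (f t) <= e.
Proof.
  intros a b H T HT f Hf w e He Hw t [Ht|Ht].
  - apply Hw. destruct t as [t [H1 H2]]. cbn in *. apply CRabs_le. split; [lin Ht | lin (H1, H1, Ht)].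
  - apply (CRle_trans _ _ _ (dist_tri _ HT _ (f (right_end H)) _)). unfold same in Hf.
    rewrite Hf, CRplus_0_l. apply Hw. destruct t as [t [H1 H2]]. cbn in *.
    apply CRabs_le. split; [lin (H2, H2, Ht) | lin Ht].
Qed.

Definition segment_incl {a b c d : X} (Hac : a <= c) (Hdb : d <= b)
  (x : subspace (segment c d)) : interval a b :=
  existT _ (projT1 x) (conj (CRle_trans _ _ _ Hac (proj1 (projT2 x)))
                            (CRle_trans _ _ _ (proj2 (projT2 x)) Hdb)).

(** J2 for a compact segment, freed of the inverse function: the modulus of [g] is the modulus of
    refinement. *)
Lemma jordan_segment_inverse : forall {a b c d : X} (gamma : interval a b -> @plane R),
  jordan_curve gamma -> forall (Hac : a < c) (Hcd : c < d) (Hdb : d < b),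
  refines (fun x => gamma (segment_incl (CRlt_asym _ _ Hac) (CRlt_asym _ _ Hdb) x))
    (fun x : subspace (segment c d) => x).
Proof.
  intros a b c d gamma J Hac Hcd Hdb e He.
  destruct (jordan_J2 _ J (segment c d)) as [g Hg Hgt].
  - intros t [H1 H2]. split.
    + apply (CRlt_le_trans _ c); assumption.
    + apply (CRle_lt_trans _ d); assumption.
  - apply segment_compact, Hcd.
  - destruct (Hg e He) as [delta Hd H]. exists delta; [exact Hd|]. intros x y Hxy.
    set (incl := segment_incl (CRlt_asym _ _ Hac) (CRlt_asym _ _ Hdb)) in *.
    pose (z := fun x => existT (image_of gamma (segment c d)) (gamma (incl x))
      (existT2 _ _ (incl x) (projT2 x) (dist_refl _ plane_metric (gamma (incl x))))).
    assert (K := H (z x) (z y) Hxy).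
    assert (Hz : forall x, projT1 (g (z x)) == projT1 x).
    { intro u. apply (Hgt (z u) (incl u)); [exact (projT2 u)|]. apply (dist_refl _ plane_metric). }
    cbn in K |- *. rewrite !Hz in K. exact K.
Qed.

(* Near the endpoints the arguments are close modulo the identification of [a]
   and [b]; away from them [J2] applies.  A point near an end cannot have its
   value close to that of an inner point: by Bishop's lemma [gamma a] is bounded
   away from the image of the inner segment. *)
Lemma jordan_refines : forall {a b : X} (gamma : interval a b -> @plane R),
  jordan_curve gamma -> forall {T : space R}, metric T ->
  forall sigma : interval a b -> T, unif_cont sigma ->
  (forall H : a <= b, same (sigma (left_end H)) (sigma (right_end H))) ->
  refines gamma sigma.
Proof.
  intros a b gamma J T HT sigma UC Hclosed e He.
  assert (Hab := path_lt _ (jordan_path _ J)). set (Hle := CRlt_asym _ _ Hab).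
  assert (Hga : same (gamma (left_end Hle)) (gamma (right_end Hle))).
  { apply (jordan_closed _ J); reflexivity. }
  assert (Hsame : forall x y, same x y -> same (gamma x) (gamma y)).
  { apply (unif_cont_same plane_metric), (path_unif_cont _ (jordan_path _ J)). }
  destruct (UC _ (half_pos e He)) as [h0 Hh0 Hsig].
  (* Outer scale: on end zones of width [w], [sigma] stays within [e / 2] of its base value. The
     bound by half the length keeps the inner segment nondegenerate. *)
  destruct (CRmin_pos h0 _ Hh0 (half_pos _ (CRlt_minus _ _ Hab))) as [w Hw [Hwh Hwab]].
  assert (Hw2 := half_pos w Hw).
  assert (Hac : a < a + w * CR_of_Q R (1#2)) by (apply (CRlt_of_diff _ _ _ Hw2); ring).
  assert (Hdb : b - w * CR_of_Q R (1#2) < b) by (apply (CRlt_of_diff _ _ _ Hw2); ring).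
  assert (Hcd : forall v, 0 < v -> v <= w ->
    a + v * CR_of_Q R (1#2) < b - v * CR_of_Q R (1#2)).
  { intros v Hv Hvw. slin Hv ((2%Q, Hvw), (2%Q, Hwab)). }
  destruct (bounded_away (subspace_metric _ _ line_metric) plane_metric
    (segment_compact _ _ (Hcd w Hw (CRle_refl w)))
    (fun x => gamma (segment_incl (CRlt_asym _ _ Hac) (CRlt_asym _ _ Hdb) x)))
    with (p := gamma (left_end Hle)) as [r Hr Hfar].
  { intros u Hu. destruct (path_unif_cont _ (jordan_path _ J) u Hu) as [d Hd H].
    exists d; [exact Hd|]. intros x y Hxy. apply H. exact Hxy. }
  { apply jordan_segment_inverse; [exact J | apply Hcd; [exact Hw | apply CRle_refl]]. }
  { intros [x [Hx1 Hx2]]. apply (jordan_J1 _ J); cbn.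
    - split; [apply (CRlt_le_trans _ _ _ Hac Hx1) | apply (CRle_lt_trans _ _ _ Hx2 Hdb)].
    - unfold apart. cbn. rewrite CRabs_minus_sym.
      apply (CRlt_le_trans _ _ _ Hw2). apply (CRle_trans _ (x - a)); [lin Hx1 | apply CRle_abs]. }
  destruct (path_unif_cont _ (jordan_path _ J) _ (half_pos r Hr)) as [k0 Hk0 Hgam].
  (* Inner scale: on end zones of width [v], [gamma] stays within [r / 2] of the base point. *)
  destruct (CRmin_pos k0 w Hk0 Hw) as [v Hv [Hvk Hvw]].
  assert (Hv2 := half_pos v Hv).
  assert (Hac' : a < a + v * CR_of_Q R (1#2)) by (apply (CRlt_of_diff _ _ _ Hv2); ring).
  assert (Hdb' : b - v * CR_of_Q R (1#2) < b) by (apply (CRlt_of_diff _ _ _ Hv2); ring).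
  destruct (jordan_segment_inverse gamma J Hac' (Hcd v Hv Hvw) Hdb' h0 Hh0) as [d1 Hd1 Hinner].
  destruct (CRmin_pos d1 _ Hd1 (half_pos _ (half_pos r Hr))) as [d Hd [Hdd1 Hdr]].
  (* If [t] is within [v] of an end, then [gamma t'] is within [r / 2 + r / 4] of the base point, so
     [t'] cannot lie in the inner segment of scale [w]. *)
  assert (Hone : forall t t', near_end v t -> dist (gamma t) (gamma t') <= d ->
    dist (sigma t) (sigma t') <= e).
  { intros t t' Ht Htt.
    assert (G : dist (gamma (left_end Hle)) (gamma t) <= r * CR_of_Q R (1#2)).
    { apply (near_end_dist Hle plane_metric gamma Hga v); [|
        |exact Ht].
      - apply CRlt_asym, half_pos, Hr.
      - intros x y Hxy. apply Hgam. lin (Hxy, Hvk). }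
    assert (Sg : forall x, near_end w x -> dist (sigma (left_end Hle)) (sigma x) <= e * CR_of_Q R (1#2)).
    { apply (near_end_dist Hle HT sigma (Hclosed Hle) w).
      - apply CRlt_asym, half_pos, He.
      - intros x y Hxy. apply Hsig. lin (Hxy, Hwh). }
    destruct (near_end_or_inner w Hw t') as [Ht'|Ht'].
    - apply (CRle_trans _ _ _ (dist_tri _ HT _ (sigma (left_end Hle)) _)).
      rewrite (dist_sym _ HT (sigma t)).
      assert (Htw : near_end w t).
      { destruct Ht as [Ht|Ht]; [left; lin (Ht, Hvw) | right; lin (Ht, Hvw)]. }
      lin (Sg t Htw, Sg t' Ht').
    - exfalso. assert (K := Hfar (existT _ (param t') Ht')). cbn beta in K.
      assert (K2 := dist_tri _ plane_metric (gamma (left_end Hle)) (gamma t') 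
         (gamma (segment_incl (CRlt_asym _ _ Hac) (CRlt_asym _ _ Hdb) (existT _ (param t') Ht')))).
      assert (K3 := dist_tri _ plane_metric (gamma (left_end Hle)) (gamma t) (gamma t')).
      set (u := segment_incl _ _ _) in K, K2.
      (* [u] is [t'] with another membership proof; their values are identified through uniform
         continuity of [gamma]. *)
      assert (Z := proj2 (Hsame t' u (dist_refl _ line_metric (param t')))).
      assert (K4 : r <= 0) by lin ((4%Q, K), (4%Q, K2), (4%Q, K3), (4%Q, Z), (4%Q, G), (4%Q, Htt), (4%Q, Hdr)).
      exact (K4 Hr). }
  exists d; [exact Hd|]. intros t t' Htt.
  destruct (near_end_or_inner v Hv t) as [Ht|Ht]; [apply Hone; assumption|].
  destruct (near_end_or_inner v Hv t') as [Ht'|Ht'].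
  - rewrite (dist_sym _ HT). apply Hone; [exact Ht'|]. rewrite (dist_sym _ plane_metric). exact Htt.
  - apply (CRle_trans _ (e * CR_of_Q R (1#2))); [|lin ((1#2)%Q, He)].
    apply Hsig. apply (Hinner (existT _ (param t) Ht) (existT _ (param t') Ht')).
    set (u := segment_incl _ _ _). set (u' := segment_incl _ _ (existT _ (param t') Ht')).
    assert (Z1 := proj2 (Hsame u t (dist_refl _ line_metric (param t)))).
    assert (Z2 := proj2 (Hsame u' t' (dist_refl _ line_metric (param t')))).
    assert (K1 := dist_tri _ plane_metric (gamma u) (gamma t) (gamma u')).
    assert (K2 := dist_tri _ plane_metric (gamma t) (gamma t') (gamma u')).
    rewrite (dist_sym _ plane_metric (gamma t') (gamma u')) in K2.
    lin (K1, K2, Z1, Z2, Htt, Hdd1).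
Qed.

(** * Cosine and sine *)

Definition CRsin (t : X) : X := Cim (cis t).

Lemma CRabs_mult_le : forall x y a b : X, CRabs R x <= a -> CRabs R y <= b ->
  CRabs R (x * y) <= a * b.
Proof.
  intros x y a b Hx Hy. rewrite CRabs_mult. apply (CRle_trans _ (a * CRabs R y)).
  - apply CRmult_le_compat_r; [apply CRabs_pos | exact Hx].
  - apply CRmult_le_compat_l; [|exact Hy]. apply (CRle_trans _ (CRabs R x)); [apply CRabs_pos | exact Hx].
Qed.

Lemma CRabs_plus_le : forall x y a b : X, CRabs R x <= a -> CRabs R y <= b ->
  CRabs R (x + y) <= a + b.
Proof.
  intros x y a b Hx Hy. apply (CRle_trans _ _ _ (CRabs_triang _ _)).
  apply CRplus_le_compat; assumption.
Qed.

Lemma INR_S : forall n, @INR R (S n) == INR n + 1.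
Proof.
  intro n. unfold INR. rewrite <- CR_of_Q_plus. apply CR_of_Q_morph.
  unfold Qeq, Qplus; cbn [Qnum Qden]. lia.
Qed.

Lemma INR_nonneg : forall n, 0 <= @INR R n.
Proof. intro n. apply CR_of_Q_le. unfold Qle; cbn [Qnum Qden]. lia. Qed.

Lemma invfact_S : forall n, INR (S n) * invfact (R:=R) (S n) == invfact n.
Proof.
  intro n. unfold INR, invfact. rewrite <- CR_of_Q_mult. apply CR_of_Q_morph.
  assert (H := lt_O_fact n). change (fact (S n)) with (S n * fact n)%nat.
  unfold Qeq, Qmult; cbn [Qnum Qden]. nia.
Qed.

Definition power_term (t : X) (n : nat) : X := CRpow t n * invfact n.

Lemma CRpow_abs_le : forall t M n, CRabs R t <= M -> CRabs R (CRpow t n) <= CRpow M n.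
Proof.
  intros t M n H. rewrite CRpow_abs. apply CRpow_le; [apply CRabs_pos | exact H].
Qed.

(** Induction by multiplying the remainder by [y]. The sharp factor 1/2 is dropped: (n + 1)(n + 2)
    then cancels against (n + 2)! and leaves the term of index [n] in [power_term_taylor]. *)
Lemma CRpow_taylor : forall (x y M : X) n, CRabs R x <= M -> CRabs R y <= M ->
  CRabs R (CRpow y (S (S n)) - CRpow x (S (S n)) - INR (S (S n)) * ((y - x) * CRpow x (S n)))
  <= INR (S n) * INR (S (S n)) * ((y - x) * (y - x) * CRpow M n).
Proof.
  intros x y M n Hx Hy.
  assert (HM : 0 <= M) by (apply (CRle_trans _ _ _ (CRabs_pos x) Hx)).
  assert (Hh := CRsq_nonneg (y - x)).
  assert (Hsq : CRabs R ((y - x) * (y - x)) <= (y - x) * (y - x)).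
  { rewrite CRabs_right; [apply CRle_refl | exact Hh]. }
  induction n as [|n IH].
  - assert (E : CRpow y 2 - CRpow x 2 - INR 2 * ((y - x) * CRpow x 1) == (y - x) * (y - x)).
    { unfold INR. cbn [CRpow Z.of_nat Pos.of_succ_nat Pos.succ]. ring. }
    rewrite E. apply (CRle_trans _ _ _ Hsq).
    unfold INR. cbn [CRpow Z.of_nat Pos.of_succ_nat Pos.succ]. lin Hh.
  - assert (E : CRpow y (S (S (S n))) - CRpow x (S (S (S n)))
        - INR (S (S (S n))) * ((y - x) * CRpow x (S (S n)))
      == y * (CRpow y (S (S n)) - CRpow x (S (S n)) - INR (S (S n)) * ((y - x) * CRpow x (S n)))
         + INR (S (S n)) * ((y - x) * (y - x) * CRpow x (S n))).
    { rewrite (INR_S (S (S n))). cbn [CRpow]. ring. }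
    rewrite E. eapply CRle_trans.
    { apply CRabs_plus_le.
      - apply CRabs_mult_le; [exact Hy | exact IH].
      - apply CRabs_mult_le.
        + rewrite CRabs_right; [apply CRle_refl | apply INR_nonneg].
        + apply CRabs_mult_le; [exact Hsq | apply CRpow_abs_le, Hx]. }
    assert (K := CRmult_le_0_compat _ _ (INR_nonneg (S (S n)))
      (CRmult_le_0_compat _ _ Hh (CRpow_ge_zero M (S n) HM))).
    rewrite (INR_S (S (S n))), (INR_S (S n)). rewrite (INR_S (S n)) in K.
    revert K. cbn [CRpow]. intro K. lin K.
Qed.

Lemma power_term_taylor : forall (x y M : X) n, CRabs R x <= M -> CRabs R y <= M ->
  CRabs R (power_term y (S (S n)) - power_term x (S (S n)) - (y - x) * power_term x (S n))
  <= (y - x) * (y - x) * power_term M n.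
Proof.
  intros x y M n Hx Hy. assert (K := CRpow_taylor x y M n Hx Hy). unfold power_term.
  assert (E : CRpow y (S (S n)) * invfact (S (S n)) - CRpow x (S (S n)) * invfact (S (S n))
      - (y - x) * (CRpow x (S n) * invfact (S n))
    == (CRpow y (S (S n)) - CRpow x (S (S n)) - INR (S (S n)) * ((y - x) * CRpow x (S n)))
       * invfact (S (S n))).
  { rewrite <- (invfact_S (S n)). ring. }
  rewrite E. rewrite CRabs_mult, (CRabs_right (invfact _)); [|apply invfact_nonneg].
  apply (CRle_trans _ _ _ (CRmult_le_compat_r _ _ _ (invfact_nonneg (S (S n))) K)).
  apply CReq_le. rewrite <- (invfact_S n), <- (invfact_S (S n)). ring.
Qed.

Lemma power_term_nonneg : forall (M : X) n, 0 <= M -> 0 <= power_term M n.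
Proof.
  intros M n H. apply CRmult_le_0_compat; [apply CRpow_ge_zero, H | apply invfact_nonneg].
Qed.

(** Differentiation shifts [rho]. Cosine and sine arise from the real and imaginary parts of the
    powers of i, so one estimate covers both. *)
Definition exp_series (rho : nat -> X) (t : X) : nat -> X := fun n => rho n * power_term t n.

Lemma exp_series_taylor : forall (rho : nat -> X) (x y M : X),
  (forall n, CRabs R (rho n) <= 1) -> CRabs R x <= M -> CRabs R y <= M -> forall n,
  CRabs R (CRsum (exp_series rho y) (S (S n)) - CRsum (exp_series rho x) (S (S n))
    - (y - x) * CRsum (exp_series (fun n => rho (S n)) x) (S n))
  <= (y - x) * (y - x) * CRsum (power_term M) n.
Proof.
  intros rho x y M Hrho Hx Hy.
  assert (Hstep : forall n, CRabs R (rho (S (S n)) *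
      (power_term y (S (S n)) - power_term x (S (S n)) - (y - x) * power_term x (S n)))
    <= (y - x) * (y - x) * power_term M n).
  { intro n. rewrite <- (CRmult_1_l ((y - x) * (y - x) * power_term M n)).
    apply CRabs_mult_le; [apply Hrho | apply power_term_taylor; assumption]. }
  induction n as [|n IH].
  - eapply CRle_trans; [|apply (Hstep O)]. apply CReq_le, CRabs_morph. cbn [CRsum].
    unfold exp_series.
    (* The terms of degree 0 and 1 have no second-order remainder, so only degree 2 is left. *)
    assert (E0 : forall t, power_term t 0 == 1) by (intro t; change (CR_of_Q R 1 * CR_of_Q R 1 == 1); ring).
    assert (E1 : forall t, power_term t 1 == t).
    { intro t. unfold power_term. change (invfact 1) with (CR_of_Q R 1). cbn [CRpow]. ring. }
    rewrite !E0, !E1. ring.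
  - cbn [CRsum] in IH |- *.
    eapply CRle_trans; [|apply CReq_le; symmetry; apply CRmult_plus_distr_l].
    eapply CRle_trans; [|apply (CRabs_plus_le _ _ _ _ IH (Hstep (S n)))].
    apply CReq_le, CRabs_morph. unfold exp_series. ring.
Qed.

Lemma exp_series_bound : forall (rho : nat -> X) (x M : X),
  (forall n, CRabs R (rho n) <= 1) -> CRabs R x <= M -> forall n,
  CRabs R (CRsum (exp_series rho x) n) <= CRsum (power_term M) n.
Proof.
  intros rho x M Hrho Hx n. apply (CRle_trans _ _ _ (multiTriangleIneg _ _)).
  apply sum_Rle. intros k _. rewrite <- (CRmult_1_l (power_term M k)).
  apply CRabs_mult_le; [apply Hrho|]. apply CRabs_mult_le; [apply CRpow_abs_le, Hx|].
  rewrite CRabs_right; [apply CRle_refl | apply invfact_nonneg].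
Qed.

(** [B] is the exponential of [M]: its series dominates the terms and, after the cancellation of
    factorials, also the remainders. *)
Lemma exp_series_estimates : forall M : X, 0 <= M -> { B : X | 0 <= B /\
  forall (rho : nat -> X) (x y f g f' : X), (forall n, CRabs R (rho n) <= 1) ->
  CRabs R x <= M -> CRabs R y <= M ->
  series_cv (exp_series rho x) f -> series_cv (exp_series rho y) g ->
  series_cv (exp_series (fun n => rho (S n)) x) f' ->
  CRabs R f <= B /\ CRabs R (g - f - (y - x) * f') <= B * ((y - x) * (y - x)) }.
Proof.
  intros M HM. destruct (exp_real_cv M HM) as [B HB].
  assert (Hpart : forall n, CRsum (power_term M) n <= B).
  { intro n. apply (growing_ineq (CRsum (power_term M))); [|exact HB].
    intro k. cbn [CRsum]. assert (K := power_term_nonneg M (S k) HM). lin K. }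
  exists B. split.
  { apply (CRle_trans _ _ _ (power_term_nonneg M 0 HM) (Hpart O)). }
  intros rho x y f g f' Hrho Hx Hy Hf Hg Hf'. split.
  - apply (CR_cv_bound_up (fun n => CRabs R (CRsum (exp_series rho x) n)) _ _ O).
    + intros n _. apply (CRle_trans _ _ _ (exp_series_bound rho x M Hrho Hx n) (Hpart n)).
    + apply CR_cv_abs_cont, Hf.
  - apply (CR_cv_bound_up (fun n => CRabs R (CRsum (exp_series rho y) (n + 2)
       - CRsum (exp_series rho x) (n + 2)
       - (y - x) * CRsum (exp_series (fun n => rho (S n)) x) (n + 1))) _ _ O).
    + intros n _. replace (n + 2)%nat with (S (S n)) by lia. replace (n + 1)%nat with (S n) by lia.
      apply (CRle_trans _ _ _ (exp_series_taylor rho x y M Hrho Hx Hy n)).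
      rewrite (CRmult_comm B). apply CRmult_le_compat_l; [apply CRsq_nonneg | apply Hpart].
    + apply CR_cv_abs_cont. apply CR_cv_minus; [apply CR_cv_minus|].
      * apply (CR_cv_shift' (CRsum (exp_series rho y)) 2), Hg.
      * apply (CR_cv_shift' (CRsum (exp_series rho x)) 2), Hf.
      * apply (CR_cv_eq _ (fun n => CRsum (exp_series (fun n => rho (S n)) x) (n + 1) * (y - x))).
        { intro n. ring. }
        apply (CR_cv_proper _ (f' * (y - x))); [|ring].
        apply CR_cv_scale, (CR_cv_shift' (CRsum (exp_series (fun n => rho (S n)) x)) 1), Hf'.
Qed.

Definition re_coef (n : nat) : X := Cre (Cpow Ci n).
Definition im_coef (n : nat) : X := Cim (Cpow Ci n).

Lemma coef_S : forall n, re_coef (S n) == - im_coef n /\ im_coef (S n) == re_coef n.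
Proof.
  intro n. unfold re_coef, im_coef. cbn [Cpow]. unfold Cmult, Ci. rewrite !CreE, !CimE.
  split; ring.
Qed.

Lemma coef_abs : forall n, CRabs R (re_coef n) <= 1 /\ CRabs R (im_coef n) <= 1.
Proof.
  induction n as [|n [H1 H2]].
  - unfold re_coef, im_coef. cbn [Cpow]. unfold Cone. rewrite CreE, CimE.
    split; rewrite CR_of_Q_abs; apply CR_of_Q_le; discriminate.
  - destruct (coef_S n) as [E1 E2]. rewrite E1, E2, CRabs_opp. split; assumption.
Qed.

Lemma Cpow_it : forall (t : X) n,
  Cre (Cpow (Cmult Ci (C_of_R t)) n) == re_coef n * CRpow t n /\
  Cim (Cpow (Cmult Ci (C_of_R t)) n) == im_coef n * CRpow t n.
Proof.
  intro t. induction n as [|n [H1 H2]].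
  - unfold re_coef, im_coef. cbn. split; ring.
  - destruct (coef_S n) as [E1 E2]. rewrite E1, E2. cbn [Cpow CRpow].
    revert H1 H2. generalize (Cpow (Cmult Ci (C_of_R t)) n). intros w H1 H2.
    unfold Cmult, Ci, C_of_R. rewrite !CreE, !CimE, H1, H2. split; ring.
Qed.

Lemma Cmult_real : forall (w : @complex R) (r : X),
  Cre (Cmult w (C_of_R r)) == Cre w * r /\ Cim (Cmult w (C_of_R r)) == Cim w * r.
Proof. intros w r. unfold Cmult, C_of_R. rewrite !CreE, !CimE. split; ring. Qed.

Lemma CRcos_series : forall t, series_cv (exp_series re_coef t) (CRcos t).
Proof.
  intro t. unfold CRcos, cis, Cexp. destruct (Cexp_exists _) as [s [H H']].
  apply series_cv_eq with (2 := H). intro n. unfold Cexp_term.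
  rewrite (proj1 (Cmult_real _ _)), (proj1 (Cpow_it t n)). unfold exp_series, power_term. ring.
Qed.

Lemma CRsin_series : forall t, series_cv (exp_series im_coef t) (CRsin t).
Proof.
  intro t. unfold CRsin, cis, Cexp. destruct (Cexp_exists _) as [s [H' H]].
  apply series_cv_eq with (2 := H). intro n. unfold Cexp_term.
  rewrite (proj2 (Cmult_real _ _)), (proj2 (Cpow_it t n)). unfold exp_series, power_term. ring.
Qed.

(** This is cos' = -sin and sin' = cos with an explicit quadratic error, uniform on bounded sets. *)
Lemma cos_sin_estimates : forall M : X, 0 <= M -> { B : X | 0 <= B /\
  forall x y : X, CRabs R x <= M -> CRabs R y <= M ->
  CRabs R (CRcos x) <= B /\ CRabs R (CRsin x) <= B /\
  CRabs R (CRcos y - CRcos x + (y - x) * CRsin x) <= B * ((y - x) * (y - x)) /\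
  CRabs R (CRsin y - CRsin x - (y - x) * CRcos x) <= B * ((y - x) * (y - x)) }.
Proof.
  intros M HM. destruct (exp_series_estimates M HM) as [B [HB H]].
  exists B. split; [exact HB|]. intros x y Hx Hy.
  destruct (H re_coef x y (CRcos x) (CRcos y) (- CRsin x)) as [H1 H2]; try assumption.
  { intro n. apply coef_abs. }
  { apply CRcos_series. }
  { apply CRcos_series. }
  { apply (series_cv_eq (fun n => - exp_series im_coef x n)).
    - intro n. unfold exp_series. rewrite (proj1 (coef_S n)). ring.
    - apply series_cv_opp, CRsin_series. }
  destruct (H im_coef x y (CRsin x) (CRsin y) (CRcos x)) as [H3 H4]; try assumption.
  { intro n. apply coef_abs. }
  { apply CRsin_series. }
  { apply CRsin_series. }
  { apply (series_cv_eq (exp_series re_coef x)).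
    - intro n. unfold exp_series. rewrite (proj2 (coef_S n)). reflexivity.
    - apply CRcos_series. }
  split; [exact H1|]. split; [exact H3|]. split; [|exact H4].
  eapply CRle_trans; [|exact H2]. apply CReq_le, CRabs_morph. ring.
Qed.

(** In [p] equal steps from 0 to [t] each increment is at most B(t/p)^2; their sum B t^2 / p is
    arbitrarily small. *)
Lemma constant_of_quadratic : forall f : X -> X,
  (forall M, 0 <= M -> { B : X | 0 <= B /\ forall x y, CRabs R x <= M -> CRabs R y <= M ->
    CRabs R (f y - f x) <= B * ((y - x) * (y - x)) }) ->
  forall t, f t == f 0.
Proof.
  intros f Hf t. destruct (Hf (CRabs R t) (CRabs_pos t)) as [B [HB H]].
  assert (Hz : CRabs R (f t - f 0) <= 0).
  { apply (CRle_0_of_all_inv _ (B * (t * t))). intro p.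
    set (q := CR_of_Q R (1 # p)).
    assert (Hq : 0 <= q) by (apply CR_of_Q_le; discriminate).
    assert (Epq : INR (Pos.to_nat p) * q == 1).
    { unfold INR, q. rewrite <- CR_of_Q_mult, positive_nat_Z. apply CR_of_Q_morph.
      unfold Qeq, Qmult; cbn [Qnum Qden]. lia. }
    assert (Hk : forall k, (k <= Pos.to_nat p)%nat -> CRabs R (INR k * q * t) <= CRabs R t).
    { intros k Hk. rewrite CRabs_mult, CRabs_right.
      2: { apply CRmult_le_0_compat; [apply INR_nonneg | exact Hq]. }
      rewrite <- (CRmult_1_l (CRabs R t)) at 2. apply CRmult_le_compat_r; [apply CRabs_pos|].
      rewrite <- Epq. apply CRmult_le_compat_r; [exact Hq|]. apply CR_of_Q_le.
      unfold Qle; cbn [Qnum Qden]. lia. }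
    assert (K : forall k, (k <= Pos.to_nat p)%nat ->
      CRabs R (f (INR k * q * t) - f 0) <= INR k * (B * (q * q * (t * t)))).
    { induction k as [|k IH]; intro Hkp.
      - assert (H0 : CRabs R 0 <= CRabs R t).
        { rewrite CRabs_right; [apply CRabs_pos | apply CRle_refl]. }
        eapply CRle_trans; [apply (H 0 (INR 0 * q * t)); [exact H0 | apply Hk, Hkp]|].
        apply CReq_le. unfold INR. cbn [Z.of_nat]. ring.
      - assert (Es : f (INR (S k) * q * t) - f 0
          == (f (INR (S k) * q * t) - f (INR k * q * t)) + (f (INR k * q * t) - f 0)) by ring.
        rewrite Es. eapply CRle_trans.
        + apply CRabs_plus_le; [apply H; apply Hk; lia | apply IH; lia].
        + apply CReq_le. rewrite INR_S. ring. }
    specialize (K _ (le_n _)).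
    assert (Et : INR (Pos.to_nat p) * q * t == t) by (rewrite Epq; ring).
    (* [f] is not assumed to respect [==]; the quadratic bound at equal arguments yields it. *)
    assert (Hft : CRabs R (f t - f (INR (Pos.to_nat p) * q * t)) <= 0).
    { eapply CRle_trans; [apply H; [apply Hk, le_n | apply CRle_refl]|].
      rewrite Et. apply CReq_le. ring. }
    assert (Es : f t - f 0 == (f t - f (INR (Pos.to_nat p) * q * t))
       + (f (INR (Pos.to_nat p) * q * t) - f 0)) by ring.
    rewrite Es. eapply CRle_trans; [apply (CRabs_plus_le _ _ _ _ Hft K)|].
    apply CReq_le.
    assert (E : 0 + INR (Pos.to_nat p) * (B * (q * q * (t * t)))
      == INR (Pos.to_nat p) * q * (B * (t * t) * q)) by ring.
    rewrite E, Epq. ring. }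
  apply CRabs_def2 in Hz. destruct Hz as [H1 H2]. split; [lin H2 | lin H1].
Qed.

(** * Addition formulas *)

Lemma cos_sin_difference : forall a x : X,
  CRcos (a + x) * CRcos x + CRsin (a + x) * CRsin x
  == CRcos (a + 0) * CRcos 0 + CRsin (a + 0) * CRsin 0 /\
  CRsin (a + x) * CRcos x - CRcos (a + x) * CRsin x
  == CRsin (a + 0) * CRcos 0 - CRcos (a + 0) * CRsin 0.
Proof.
  intros a x.
  assert (Main : forall M, 0 <= M -> { B : X | 0 <= B /\
    forall x y, CRabs R x <= M -> CRabs R y <= M ->
    CRabs R ((CRcos (a + y) * CRcos y + CRsin (a + y) * CRsin y)
      - (CRcos (a + x) * CRcos x + CRsin (a + x) * CRsin x)) <= B * ((y - x) * (y - x)) /\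
    CRabs R ((CRsin (a + y) * CRcos y - CRcos (a + y) * CRsin y)
      - (CRsin (a + x) * CRcos x - CRcos (a + x) * CRsin x)) <= B * ((y - x) * (y - x)) }).
  { intros M HM.
    destruct (cos_sin_estimates (CRabs R a + M)) as [B [HB H]].
    { apply CRplus_nonneg; [apply CRabs_pos | exact HM]. }
    (* One summand for each of the six terms of the expansions [E] below; [M + M] bounds the
       increment [h]. *)
    set (C := B * B + B * B + (B + (M + M) * B) * B + B * B + (B + (M + M) * B) * B + B * B).
    assert (HC : 0 <= C).
    { unfold C. repeat first [exact HB | exact HM | apply CRmult_le_0_compat | refine (CRplus_nonneg _ _ _ _)]. }
    exists C. split; [exact HC|].
    intros u v Hu Hv.
    assert (Hau : CRabs R (a + u) <= CRabs R a + M) by (apply CRabs_plus_le; [apply CRle_refl | exact Hu]).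
    assert (Hav : CRabs R (a + v) <= CRabs R a + M) by (apply CRabs_plus_le; [apply CRle_refl | exact Hv]).
    assert (Ha := CRabs_pos a).
    assert (Hu' : CRabs R u <= CRabs R a + M) by lin (Hu, Ha).
    assert (Hv' : CRabs R v <= CRabs R a + M) by lin (Hv, Ha).
    destruct (H (a + u) (a + v) Hau Hav) as [c1B [s1B [Hal Hbe]]].
    destruct (H u v Hu' Hv') as [_ [_ [Hga Hde]]].
    destruct (H v u Hv' Hu') as [C2B [S2B _]].
    destruct (H u v Hu' Hv') as [c2B [s2B _]].
    assert (Ed : a + v - (a + u) == v - u) by ring. rewrite Ed in Hal, Hbe.
    assert (Hh : CRabs R (v - u) <= M + M).
    { apply CRabs_plus_le; [exact Hv | rewrite CRabs_opp; exact Hu]. }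
    revert c1B s1B Hal Hbe Hga Hde C2B S2B c2B s2B Hh.
    generalize (CRcos (a + u)), (CRsin (a + u)), (CRcos (a + v)), (CRsin (a + v)),
      (CRcos u), (CRsin u), (CRcos v), (CRsin v), (v - u).
    intros c1 s1 C1 S1 c2 s2 C2 S2 h c1B s1B Hal Hbe Hga Hde C2B S2B c2B s2B Hh.
    assert (Hhh : CRabs R (h * h) <= h * h).
    { rewrite CRabs_right; [apply CRle_refl | apply CRsq_nonneg]. }
    assert (K1 : CRabs R (c1 - h * s1) <= B + (M + M) * B).
    { apply CRabs_plus_le; [exact c1B|]. rewrite CRabs_opp. apply CRabs_mult_le; assumption. }
    assert (K2 : CRabs R (s1 + h * c1) <= B + (M + M) * B).
    { apply CRabs_plus_le; [exact s1B|]. apply CRabs_mult_le; assumption. }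
    split.
    (* The first-order terms cancel: each summand contains [h * h] or a quadratic remainder as a
       factor. *)
    - assert (E : C1 * C2 + S1 * S2 - (c1 * c2 + s1 * s2)
        == h * h * (c1 * c2) + h * h * (s1 * s2) + (c1 - h * s1) * (C2 - c2 + h * s2)
           + (C1 - c1 + h * s1) * C2 + (s1 + h * c1) * (S2 - s2 - h * c2)
           + (S1 - s1 - h * c1) * S2) by ring.
      rewrite E. eapply CRle_trans.
      { repeat first [eassumption | apply CRabs_mult_le | refine (CRabs_plus_le _ _ _ _ _ _)]. }
      apply CReq_le. unfold C. ring.
    - assert (E : S1 * C2 - C1 * S2 - (s1 * c2 - c1 * s2)
        == h * h * (s1 * c2) + h * h * - (c1 * s2) + (s1 + h * c1) * (C2 - c2 + h * s2)
           + (S1 - s1 - h * c1) * C2 + (c1 - h * s1) * - (S2 - s2 - h * c2)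
           + (C1 - c1 + h * s1) * - S2) by ring.
      rewrite E. eapply CRle_trans.
      { repeat first [eassumption | rewrite CRabs_opp; eassumption
          | apply CRabs_mult_le | rewrite CRabs_opp; apply CRabs_mult_le
          | refine (CRabs_plus_le _ _ _ _ _ _)]. }
      apply CReq_le. unfold C. ring. }
  split.
  - apply (constant_of_quadratic (fun x => CRcos (a + x) * CRcos x + CRsin (a + x) * CRsin x)).
    intros M HM. destruct (Main M HM) as [B [HB H]]. exists B. split; [exact HB|].
    intros u v Hu Hv. apply H; assumption.
  - apply (constant_of_quadratic (fun x => CRsin (a + x) * CRcos x - CRcos (a + x) * CRsin x)).
    intros M HM. destruct (Main M HM) as [B [HB H]]. exists B. split; [exact HB|].
    intros u v Hu Hv. apply H; assumption.
Qed.

Lemma CRcos_sin_proper : forall x y : X, x == y ->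
  CRcos x == CRcos y /\ CRsin x == CRsin y.
Proof.
  intros x y H.
  destruct (cos_sin_estimates (CRabs R y) (CRabs_pos y)) as [B [_ K]].
  assert (Hx : CRabs R x <= CRabs R y) by (rewrite H; apply CRle_refl).
  destruct (K x y Hx (CRle_refl _)) as [_ [_ [K1 K2]]].
  assert (E : y - x == 0) by (rewrite H; ring).
  rewrite E in K1, K2. apply CRabs_def2 in K1, K2.
  destruct K1 as [K1 K1'], K2 as [K2 K2'].
  split; split; [lin K1 | lin K1' | lin K2 | lin K2'].
Qed.

#[local] Instance CRcos_morph : Morphisms.Proper (Morphisms.respectful (CReq R) (CReq R)) CRcos.
Proof. intros x y H. apply CRcos_sin_proper, H. Qed.

#[local] Instance CRsin_morph : Morphisms.Proper (Morphisms.respectful (CReq R) (CReq R)) CRsin.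
Proof. intros x y H. apply CRcos_sin_proper, H. Qed.

Lemma CRcos_0 : CRcos (R:=R) 0 == 1.
Proof.
  rewrite CRcos_cosq, (cosq_proper (R:=R) (0 * 0) 0); [apply cosq_0 | ring].
Qed.

Lemma CRsin_0 : CRsin 0 == 0.
Proof.
  apply (CR_cv_unique (CRsum (exp_series im_coef 0))); [apply CRsin_series|].
  apply (CR_cv_eq _ (fun _ => 0)); [|apply CR_cv_const].
  intro n. symmetry. apply sum_eq_R0. intros [|k]; unfold exp_series, power_term.
  - change (im_coef 0) with (CR_of_Q R 0). ring.
  - cbn [CRpow]. ring.
Qed.

Lemma CRcos_sin_sq : forall x : X, CRcos x * CRcos x + CRsin x * CRsin x == 1.
Proof.
  intro x. destruct (cos_sin_difference 0 x) as [H _].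
  assert (E : forall y : X, 0 + y == y) by (intro y; ring).
  rewrite !E, CRcos_0, CRsin_0 in H. rewrite H. ring.
Qed.

(** The difference formulas are a linear system for the values at [a + x] whose determinant is cos^2
    + sin^2 = 1; this is its solution. *)
Lemma CRcos_sin_plus : forall a x : X,
  CRcos (a + x) == CRcos a * CRcos x - CRsin a * CRsin x /\
  CRsin (a + x) == CRsin a * CRcos x + CRcos a * CRsin x.
Proof.
  intros a x. destruct (cos_sin_difference a x) as [H1 H2].
  assert (E : a + 0 == a) by ring.
  rewrite E, CRcos_0, CRsin_0 in H1, H2.
  assert (Hsq := CRcos_sin_sq x).
  assert (K1 : CRcos a == CRcos (a + x) * CRcos x + CRsin (a + x) * CRsin x) by (rewrite H1; ring).
  assert (K2 : CRsin a == CRsin (a + x) * CRcos x - CRcos (a + x) * CRsin x) by (rewrite H2; ring).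
  rewrite K1, K2.
  revert Hsq. generalize (CRcos x), (CRsin x), (CRcos (a + x)), (CRsin (a + x)).
  intros c s C S Hsq. split.
  - assert (E1 : (C * c + S * s) * c - (S * c - C * s) * s == C * (c * c + s * s)) by ring.
    rewrite E1, Hsq. ring.
  - assert (E1 : (S * c - C * s) * c + (C * c + S * s) * s == S * (c * c + s * s)) by ring.
    rewrite E1, Hsq. ring.
Qed.

Lemma CRcos_sin_opp : forall x : X, CRcos (- x) == CRcos x /\ CRsin (- x) == - CRsin x.
Proof.
  intro x. destruct (cos_sin_difference (- x) x) as [H1 H2].
  assert (E : - x + x == 0) by ring. assert (E0 : - x + 0 == - x) by ring.
  rewrite E, E0, CRcos_0, CRsin_0 in H1, H2. split.
  - assert (K : CRcos (- x) == 1 * CRcos x + 0 * CRsin x) by (rewrite H1; ring).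
    rewrite K. ring.
  - assert (K : CRsin (- x) == 0 * CRcos x - 1 * CRsin x) by (rewrite H2; ring).
    rewrite K. ring.
Qed.

Lemma coef_even_odd : forall k,
  im_coef (2 * k) == 0 /\ im_coef (S (2 * k)) == CRsgn k.
Proof.
  intro k.
  destruct (Cpow_imag (R:=R) Ci 1 (CReq_refl _) (CReq_refl _) k) as [H1 [H2 _]].
  split; [exact H2|]. rewrite (proj2 (coef_S _)). unfold re_coef. rewrite H1.
  assert (E : CRpow (1 * 1) k == CRpow (R:=R) 1 k) by (apply CRpow_proper; ring).
  rewrite E, CRpow_one. ring.
Qed.

(* The sine series alternates with terms decreasing by a factor 2 when [t^2 <= 3]. *)
Lemma CRsin_ge_half : forall t : X, 0 <= t -> t * t <= CR_of_Q R 3 ->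
  t * CR_of_Q R (1#2) <= CRsin t.
Proof.
  intros t Ht Ht3.
  pose (a := fun k => t * (CRpow (t * t) k * invfact (S (2 * k)))).
  assert (Hp : forall k, 0 <= CRpow (t * t) k) by (intro k; apply CRpow_ge_zero, CRsq_nonneg).
  assert (Hcoef : forall k, invfact (R:=R) (S (2 * S k)) <= CR_of_Q R (1#6) * invfact (S (2 * k))).
  { intro k. rewrite <- (invfact_S (S (2 * k))), <- (invfact_S (S (S (2 * k)))).
    replace (S (S (S (2 * k)))) with (S (2 * S k)) by lia.
    rewrite <- !CRmult_assoc.
    rewrite <- (CRmult_1_l (invfact (S (2 * S k)))) at 1.
    apply CRmult_le_compat_r; [apply invfact_nonneg|]. unfold INR. rewrite <- !CR_of_Q_mult.
    apply CR_of_Q_le. unfold Qle, Qmult; cbn [Qnum Qden]. nia. }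
  assert (Hpow : forall k, CRpow t (S (2 * k)) == t * CRpow (t * t) k).
  { intro k. rewrite <- CRpow_mult, CRpow_plus_distr. replace (k + k)%nat with (2 * k)%nat by lia.
    reflexivity. }
  assert (Hsum : forall n, CRsum (exp_series im_coef t) (S (2 * n)) == CRsum (fun k => a k * CRsgn k) n).
  { assert (Hterm : forall k, exp_series im_coef t (2 * k) == 0 /\
      exp_series im_coef t (S (2 * k)) == a k * CRsgn k).
    { intro k. destruct (coef_even_odd k) as [E1 E2]. unfold exp_series. rewrite E1, E2. split; [ring|].
      unfold power_term, a. rewrite Hpow. ring. }
    induction n as [|n IH].
    - cbn [CRsum]. destruct (Hterm O) as [E1 E2].
      change (2 * 0)%nat with O in E1, E2 |- *. cbn [CRsum]. rewrite E1, E2. ring.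
    - replace (S (2 * S n)) with (S (S (S (2 * n)))) by lia. cbn [CRsum] in IH |- *.
      rewrite IH. destruct (Hterm (S n)) as [E1 E2].
      replace (2 * S n)%nat with (S (S (2 * n))) in E1, E2 by lia. rewrite E1, E2. ring. }
  assert (Ha : forall k, 0 <= a k).
  { intro k. unfold a. apply CRmult_le_0_compat; [exact Ht|].
    apply CRmult_le_0_compat; [apply Hp | apply invfact_nonneg]. }
  assert (Hdec : forall k, a (S k) <= a k * CR_of_Q R (1 # 2)).
  { intro k. unfold a. cbn [CRpow].
    assert (H0 : 0 <= t * CRpow (t * t) k) by (apply CRmult_le_0_compat; [exact Ht | apply Hp]).
    assert (H1 := CRmult_le_compat_l _ _ _ (CRmult_le_0_compat _ _ H0 (CRsq_nonneg t)) (Hcoef k)).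
    assert (H2 := CRmult_le_compat_l _ _ _
      (CRmult_le_0_compat _ _ H0 (invfact_nonneg (S (2 * k)))) Ht3).
    lin (H1, ((1#6)%Q, H2)). }
  apply (CR_cv_bound_down (fun n => CRsum (exp_series im_coef t) (S (2 * n))) _ _ O).
  - intros n _. rewrite Hsum. destruct (alt_sum_bounds n a Ha Hdec) as [_ H].
    apply (CRle_trans _ (a O - a 1%nat)); [|exact H].
    assert (E : a O == t).
    { unfold a. change (invfact (S (2 * 0))) with (CR_of_Q R 1). cbn [CRpow]. ring. }
    assert (K := Hdec O). rewrite E in K |- *. lin K.
  - intro p. destruct (CRsin_series t p) as [N HN]. exists N. intros i Hi. apply HN. lia.
Qed.

(** * Values at multiples of pi/2 and lengths of chords *)

Definition half_pi : X := CRpi * CR_of_Q R (1#2).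

Lemma CRpi_spec : is_pi (CRpi (R:=R)).
Proof. unfold CRpi. destruct CRpi_exists as [p Hp]. exact Hp. Qed.

Lemma half_pi_pos : 0 < half_pi.
Proof. apply half_pos, (is_pi_pos _ CRpi_spec). Qed.

(** Derived from [is_pi] alone: the cosine vanishes at the root [r] of the zero of [cosq], so [r]
    cannot lie below [half_pi], where the cosine is positive. *)
Lemma half_pi_sq : half_pi * half_pi <= CR_of_Q R 3.
Proof.
  destruct (cosq_zero (R:=R)) as [l [[Hl0 Hl3] [_ Hl]]].
  destruct (CRsqrt_exists l Hl0) as [r [Hr0 Hr]].
  assert (H : half_pi <= r).
  { intro Hlt. assert (K := is_pi_cos_pos _ CRpi_spec r Hr0 Hlt).
    rewrite CRcos_cosq, (cosq_proper _ _ Hr), Hl in K. exact (CRle_refl _ K). }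
  apply (CRle_trans _ (r * r)); [apply CRsq_le; [apply CRlt_asym, half_pi_pos | exact H]|].
  rewrite Hr. exact Hl3.
Qed.

Lemma CRcos_half_pi : CRcos half_pi == 0.
Proof. apply (is_pi_cos_half _ CRpi_spec). Qed.

Lemma CRsin_half_pi : CRsin half_pi == 1.
Proof.
  apply CRsq_inj; [|apply CR_of_Q_nonneg; reflexivity|].
  - assert (K := CRsin_ge_half _ (CRlt_asym _ _ half_pi_pos) half_pi_sq).
    assert (P := half_pi_pos). lin (K, ((1#2)%Q, P)).
  - assert (K := CRcos_sin_sq half_pi). rewrite CRcos_half_pi in K.
    assert (E : CRsin half_pi * CRsin half_pi == 0 * 0 + CRsin half_pi * CRsin half_pi) by ring.
    rewrite E, K. ring.
Qed.

Lemma cos_sin_pi : CRcos (R:=R) CRpi == - (1) /\ CRsin CRpi == 0.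
Proof.
  assert (E : CRpi == half_pi + half_pi) by (unfold half_pi; ring).
  destruct (CRcos_sin_plus half_pi half_pi) as [H1 H2].
  rewrite E, H1, H2, CRcos_half_pi, CRsin_half_pi. split; ring.
Qed.

Lemma cos_sin_two_pi : CRcos (R:=R) two_pi == 1 /\ CRsin two_pi == 0.
Proof.
  assert (E : two_pi == CRpi (R:=R) + CRpi) by (unfold two_pi; ring).
  destruct (CRcos_sin_plus CRpi CRpi) as [H1 H2], cos_sin_pi as [H3 H4].
  rewrite E, H1, H2, H3, H4. split; ring.
Qed.

(** Up to pi/2 this is [CRsin_ge_half]; beyond, reflect by sin x = sin (pi - x). *)
Lemma CRsin_lower : forall e x : X, 0 <= e -> e <= x -> x <= CRpi - e ->
  e * CR_of_Q R (1#2) <= CRsin x.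
Proof.
  assert (H : forall e x : X, 0 <= e -> e <= x -> x <= half_pi -> e * CR_of_Q R (1#2) <= CRsin x).
  { intros e x He Hx Hxp. assert (Hx0 := CRle_trans _ _ _ He Hx).
    apply (CRle_trans _ (x * CR_of_Q R (1#2))); [lin ((1#2)%Q, Hx)|].
    apply CRsin_ge_half; [exact Hx0|].
    apply (CRle_trans _ (half_pi * half_pi)); [apply CRsq_le; assumption | apply half_pi_sq]. }
  intros e x He Hx Hxp. apply (CRle_cases _ _ x half_pi).
  - apply H; assumption.
  - intro Hge. destruct (CRcos_sin_plus CRpi (- x)) as [_ E].
    destruct (CRcos_sin_opp x) as [_ E1], cos_sin_pi as [E2 E3].
    rewrite E1, E2, E3 in E.
    assert (E4 : CRsin x == CRsin (CRpi + - x)) by (rewrite E; ring).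
    rewrite E4. apply H; [exact He | lin Hxp |].
    assert (Eh : CRpi == half_pi + half_pi) by (unfold half_pi; ring).
    rewrite Eh. lin Hge.
Qed.

(** The chord formula 2 |sin ((s - t) / 2)|, squared to avoid the absolute value, by expansion about
    the mean angle [m]. *)
Lemma cis_dist_sq : forall s t : X,
  dist (s:=plane) (cis s) (cis t) * dist (s:=plane) (cis s) (cis t)
  == CR_of_Q R 4 * (CRsin ((s - t) * CR_of_Q R (1#2)) * CRsin ((s - t) * CR_of_Q R (1#2))).
Proof.
  intros s t. rewrite plane_dist_sq.
  fold (CRcos s) (CRcos t) (CRsin s) (CRsin t).
  set (m := (s + t) * CR_of_Q R (1#2)). set (d := (s - t) * CR_of_Q R (1#2)).
  assert (Es : s == m + d) by (unfold m, d; ring).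
  assert (Et : t == m + - d) by (unfold m, d; ring).
  destruct (CRcos_sin_plus m d) as [H1 H2], (CRcos_sin_plus m (- d)) as [H3 H4].
  destruct (CRcos_sin_opp d) as [H5 H6].
  rewrite (CRcos_morph _ _ Es), (CRcos_morph _ _ Et), (CRsin_morph _ _ Es), (CRsin_morph _ _ Et).
  rewrite H1, H2, H3, H4, H5, H6.
  assert (K := CRcos_sin_sq m).
  assert (E : CR_of_Q R 4 * (CRsin d * CRsin d)
    == CR_of_Q R 4 * (CRsin d * CRsin d) * (CRcos m * CRcos m + CRsin m * CRsin m)).
  { rewrite K. ring. }
  rewrite E. ring.
Qed.

Lemma cis_dist_lower : forall e s t : X, 0 <= e -> e <= s - t -> s - t <= two_pi - e ->
  e * CR_of_Q R (1#2) <= dist (s:=plane) (cis s) (cis t).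
Proof.
  intros e s t He H1 H2.
  apply CRsq_le_cancel; [apply (dist_nonneg _ plane_metric)|]. rewrite cis_dist_sq.
  assert (H : e * CR_of_Q R (1#2) * CR_of_Q R (1#2) <= CRsin ((s - t) * CR_of_Q R (1#2))).
  { apply CRsin_lower.
    - apply CRmult_le_0_compat; [exact He | apply CR_of_Q_nonneg; reflexivity].
    - lin ((1#2)%Q, H1).
    - unfold two_pi in H2. lin ((1#2)%Q, H2). }
  assert (K := CRsq_le _ _ (CRmult_le_0_compat _ _ (CRmult_le_0_compat _ _ He
    (CR_of_Q_nonneg (1#2) eq_refl)) (CR_of_Q_nonneg (1#2) eq_refl)) H).
  lin (4%Q, K).
Qed.

Lemma cis_lipschitz : { L : X | 0 <= L /\ forall s t : X,
  CRabs R (s - t) <= two_pi -> dist (s:=plane) (cis s) (cis t) <= L * CRabs R (s - t) }.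
Proof.
  assert (H0 : 0 <= two_pi (R:=R)).
  { apply CRscale_nonneg; [apply CRlt_asym, (is_pi_pos _ CRpi_spec) | reflexivity]. }
  destruct (cos_sin_estimates two_pi H0) as [B [HB H]].
  exists (1 + B * two_pi).
  assert (HL : 0 <= 1 + B * two_pi).
  { apply CRplus_nonneg; [apply CR_of_Q_nonneg; reflexivity | apply CRmult_le_0_compat; assumption]. }
  split; [exact HL|].
  intros s t Hst. assert (Ha := CRabs_pos (s - t)).
  set (d := (s - t) * CR_of_Q R (1#2)).
  assert (Ed : CRabs R d == CRabs R (s - t) * CR_of_Q R (1#2)).
  { unfold d. rewrite CRabs_mult, (CRabs_right (CR_of_Q R (1#2))); [reflexivity|].
    apply CR_of_Q_nonneg. reflexivity. }
  assert (Hd : CRabs R d <= two_pi) by (rewrite Ed; lin (((1#2)%Q, Hst), ((1#2)%Q, H0))).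
  assert (Hz : CRabs R 0 <= two_pi) by (rewrite CRabs_right; [exact H0 | apply CRle_refl]).
  destruct (H 0 d Hz Hd) as [_ [_ [_ K]]]. rewrite CRsin_0, CRcos_0 in K.
  assert (Ks : CRabs R (CRsin d) <= (1 + B * two_pi) * CRabs R d).
  { assert (E : CRsin d == (CRsin d - 0 - (d - 0) * 1) + d) by ring.
    rewrite E. eapply CRle_trans; [apply (CRabs_plus_le _ _ _ _ K (CRle_refl _))|].
    assert (E2 : (d - 0) * (d - 0) == CRabs R d * CRabs R d) by (rewrite CRabs_sq; ring).
    rewrite E2.
    assert (K2 := CRmult_le_compat_l _ _ _ (CRmult_le_0_compat _ _ HB (CRabs_pos d)) Hd).
    lin K2. }
  apply CRsq_le_cancel.
  { apply CRmult_le_0_compat; assumption. }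
  rewrite cis_dist_sq. fold d. rewrite <- (CRabs_sq (CRsin d)).
  assert (K3 := CRsq_le _ _ (CRabs_pos _) Ks). rewrite Ed in K3. lin (4%Q, K3).
Qed.

(** * The unit circle *)

Lemma contraction_fixed_point : forall {S : space R}, metric S -> complete S ->
  forall f : S -> S, (forall x y, dist (f x) (f y) <= dist x y * CR_of_Q R (1#2)) ->
  S -> { l : S | same (f l) l }.
Proof.
  intros Y HY CY f Hf x0.
  pose (it := fun n => Nat.iter n f x0). set (D := dist x0 (f x0)).
  (* [2 * D] is the sum of the geometric series bounding the successive steps. *)
  assert (H0 : forall k, dist x0 (it k) <= CR_of_Q R 2 * D).
  { assert (HD := dist_nonneg _ HY x0 (f x0)). fold D in HD.
    induction k as [|k IH].
    - cbn. rewrite (dist_refl _ HY). lin (2%Q, HD).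
    - apply (CRle_trans _ _ _ (dist_tri _ HY _ (f x0) _)). fold D.
      change (it (S k)) with (f (it k)). assert (K := Hf x0 (it k)). lin (K, ((1#2)%Q, IH)). }
  assert (Hn : forall n k, dist (it n) (it (n + k)%nat)
      <= CRpow (CR_of_Q R (1#2)) n * (CR_of_Q R 2 * D)).
  { induction n as [|n IH]; intro k.
    - cbn [CRpow]. assert (K := H0 k). change (it (0 + k)%nat) with (it k).
      change (it O) with x0. lin K.
    - change (it (S n + k)%nat) with (f (it (n + k)%nat)). change (it (S n)) with (f (it n)).
      assert (K := Hf (it n) (it (n + k)%nat)). assert (K2 := IH k).
      cbn [CRpow]. lin (K, ((1#2)%Q, K2)). }
  destruct (CY it) as [l Hl].
  { intros e He. destruct (pos_fraction_lt _ (half_pos e He)) as [p Hp].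
    destruct (CR_cv_scale _ (CR_of_Q R 2 * D) _ GeoCvZero p) as [N HN].
    specialize (HN N (le_n N)). apply CRabs_def2 in HN. destruct HN as [HN _].
    exists N. intros m n Hm Hn'.
    apply (CRle_trans _ _ _ (dist_tri _ HY _ (it N) _)). rewrite (dist_sym _ HY (it m)).
    assert (K1 := Hn N (m - N)%nat). assert (K2 := Hn N (n - N)%nat).
    replace (N + (m - N))%nat with m in K1 by lia. replace (N + (n - N))%nat with n in K2 by lia.
    lin (K1, K2, HN, HN, (2%Q, Hp)). }
  exists l. apply CReq0_all_pos; [apply (dist_nonneg _ HY)|]. intros e He.
  destruct (Hl _ (half_pos e He)) as [N HN].
  assert (K1 := HN N (le_n N)). assert (K2 := HN (S N) (le_S _ _ (le_n N))).
  assert (K3 := Hf l (it N)). rewrite (dist_sym _ HY l) in K3.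
  assert (K4 := dist_tri _ HY (f l) (it (S N)) l). change (it (S N)) with (f (it N)) in K2, K4.
  lin (K4, K2, K3, ((1#2)%Q, K1), ((1#4)%Q, He)).
Qed.

(** The exact intermediate value theorem is not constructive. Instead [cosq u == c] is solved by the
    fixed point of the contraction [cosq_step u - 2 * c] of [0, 3], and [t] is the square root of
    [u]. *)
Lemma CRarccos : forall c : X, 0 <= c -> c <= 1 ->
  { t : X | 0 <= t /\ t <= half_pi /\ t * t <= CR_of_Q R 3 /\ CRcos t == c }.
Proof.
  intros c Hc Hc1.
  assert (H03 : 0 < CR_of_Q R 3) by (apply CR_of_Q_lt; reflexivity).
  assert (Hin : forall u : subspace (segment 0 (CR_of_Q R 3)),
    0 <= cosq_step (projT1 u) - CR_of_Q R 2 * c <= CR_of_Q R 3).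
  { intros [u Hu]. cbn. assert (K1 := cosq_step_lb u Hu). destruct (cosq_step_in03 u Hu) as [_ K2].
    split; [lin (K1, (2%Q, Hc1)) | lin (K2, (2%Q, Hc))]. }
  destruct (contraction_fixed_point (subspace_metric _ _ line_metric)
    (fst (segment_compact _ _ H03))
    (fun u => existT _ (cosq_step (projT1 u) - CR_of_Q R 2 * c) (Hin u))) as [[u Hu] Hfix].
  - intros [u Hu] [v Hv]. cbn.
    eapply CRle_trans; [|apply (cosq_step_contract u v Hu Hv)].
    apply CReq_le, CRabs_morph. ring.
  - exists 0. split; [apply CRle_refl | apply CRlt_asym, H03].
  - unfold same in Hfix. cbn in Hfix.
    assert (Hcu : cosq u == c).
    { assert (K := proj2 Hfix). apply CRabs_def2 in K. destruct K as [K1 K2].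
      unfold cosq_step in K1, K2. split; [lin ((1#2)%Q, K2) | lin ((1#2)%Q, K1)]. }
    destruct (CRsqrt_exists u (proj1 Hu)) as [t [Ht Htu]]. exists t.
    assert (Hcos : CRcos t == c) by (rewrite CRcos_cosq, (cosq_proper _ _ Htu); exact Hcu).
    assert (Ht3 : t * t <= CR_of_Q R 3) by (rewrite Htu; apply Hu).
    split; [exact Ht|]. split; [|split; [exact Ht3 | exact Hcos]].
    apply CRsq_le_cancel; [apply CRlt_asym, half_pi_pos|].
    apply (CRle_cases _ _ (t * t) (half_pi * half_pi)); intro H; [exact H|].
    destruct (cosq_decr (half_pi * half_pi) (t * t)) as [K _].
    + split; [apply CRsq_nonneg | apply half_pi_sq].
    + split; [apply CRsq_nonneg | exact Ht3].
    + exact H.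
    + rewrite <- !CRcos_cosq, CRcos_half_pi, Hcos in K. lin ((4%Q, K), (4%Q, Hc)).
Qed.

Lemma CRabs_near : forall x e : X, 0 <= e -> - e <= x -> CRabs R (CRabs R x - x) <= CR_of_Q R 2 * e.
Proof.
  intros x e He Hx.
  assert (H : CRabs R x <= x + CR_of_Q R 2 * e) by (apply CRabs_le; split; [lin (2%Q, Hx) | lin (2%Q, He)]).
  rewrite CRabs_right; [lin H|]. assert (K := CRle_abs x). lin K.
Qed.

Definition on_circle (z : @plane R) : Prop := Cre z * Cre z + Cim z * Cim z == 1.

(** The quadrant is known only up to [e]; the angle is that of (|x|, |y|), which lies exactly in the
    first quadrant and within [4 * e] of [z]. *)
Lemma first_quadrant : forall (z : @plane R) (e : X), 0 <= e -> on_circle z ->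
  - e <= Cre z -> - e <= Cim z ->
  { t : X | 0 <= t /\ t <= half_pi /\ dist (s:=plane) (cis t) z <= CR_of_Q R 4 * e }.
Proof.
  intros z e He Hz Hx Hy. unfold on_circle in Hz.
  assert (Hx1 : CRabs R (Cre z) <= 1).
  { apply CRsq_le_cancel; [apply CR_of_Q_nonneg; reflexivity|]. rewrite CRabs_sq.
    assert (K := CRsq_nonneg (Cim z)). lin (K, Hz). }
  destruct (CRarccos _ (CRabs_pos _) Hx1) as [t [Ht [Htp [Ht3 Hcos]]]].
  exists t. split; [exact Ht|]. split; [exact Htp|].
  assert (Hsin : CRsin t == CRabs R (Cim z)).
  { apply CRsq_inj; [| apply CRabs_pos |].
    - assert (K := CRsin_ge_half t Ht Ht3). lin (K, ((1#2)%Q, Ht)).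
    - assert (K := CRcos_sin_sq t). rewrite Hcos, CRabs_sq in K. rewrite CRabs_sq.
      assert (E : CRsin t * CRsin t == (Cre z * Cre z + CRsin t * CRsin t) - Cre z * Cre z) by ring.
      rewrite E, K, <- Hz. ring. }
  apply (CRle_trans _ _ _ (plane_dist_le_sum _ _)).
  change (CRabs R (CRcos t - Cre z) + CRabs R (CRsin t - Cim z) <= CR_of_Q R 4 * e).
  rewrite Hcos, Hsin. assert (K1 := CRabs_near _ e He Hx). assert (K2 := CRabs_near _ e He Hy).
  lin (K1, K2).
Qed.

(** Multiplication by -i. *)
Definition turn_back (z : @plane R) : @plane R := (Cim z, - Cre z).

Lemma cis_quarter_turn : forall (z : @plane R) (t : X),
  dist (s:=plane) (cis (t + half_pi)) z == dist (s:=plane) (cis t) (turn_back z).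
Proof.
  intros z t. apply CRsq_inj; [apply (dist_nonneg _ plane_metric) | apply (dist_nonneg _ plane_metric)|].
  rewrite !plane_dist_sq. destruct (CRcos_sin_plus t half_pi) as [H1 H2].
  fold (CRcos (t + half_pi)) (CRsin (t + half_pi)) (CRcos t) (CRsin t).
  rewrite H1, H2, CRcos_half_pi, CRsin_half_pi. unfold turn_back. rewrite CreE, CimE. ring.
Qed.

(** Signs of coordinates are undecidable, so four overlapping quadrants with tolerance [e / 4] are
    used, each turned back into the first; [first_quadrant] loses the factor 4. *)
Lemma on_circle_approx : forall z : @plane R, on_circle z -> forall e : X, 0 < e ->
  { t : interval 0 two_pi | dist z (upsilon t) <= e }.
Proof.
  assert (Turn : forall (z : @plane R) (e b : X),
    { t : X | 0 <= t /\ t <= b /\ dist (s:=plane) (cis t) (turn_back z) <= e } ->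
    { t : X | 0 <= t /\ t <= b + half_pi /\ dist (s:=plane) (cis t) z <= e }).
  { intros z e b [t [H1 [H2 H3]]]. exists (t + half_pi). assert (P := half_pi_pos).
    split; [lin (H1, P)|]. split; [lin H2|]. rewrite cis_quarter_turn. exact H3. }
  assert (Circ : forall z, on_circle z -> on_circle (turn_back z)).
  { intros z H. unfold on_circle in *. unfold turn_back. rewrite CreE, CimE, <- H. ring. }
  assert (Q2 : forall (z : @plane R) (e : X), 0 <= e -> on_circle z -> Cre z <= e -> - e <= Cim z ->
    { t : X | 0 <= t /\ t <= half_pi + half_pi /\ dist (s:=plane) (cis t) z <= CR_of_Q R 4 * e }).
  { intros z e He Hz Hx Hy. apply Turn. apply first_quadrant; [exact He | apply Circ, Hz | exact Hy |].
    change (- e <= - Cre z). lin Hx. }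
  assert (Q3 : forall (z : @plane R) (e : X), 0 <= e -> on_circle z -> Cre z <= e -> Cim z <= e ->
    { t : X | 0 <= t /\ t <= half_pi + half_pi + half_pi /\
      dist (s:=plane) (cis t) z <= CR_of_Q R 4 * e }).
  { intros z e He Hz Hx Hy. apply Turn, Q2; [exact He | apply Circ, Hz | exact Hy |].
    change (- e <= - Cre z). lin Hx. }
  assert (Q4 : forall (z : @plane R) (e : X), 0 <= e -> on_circle z -> - e <= Cre z -> Cim z <= e ->
    { t : X | 0 <= t /\ t <= half_pi + half_pi + half_pi + half_pi /\
      dist (s:=plane) (cis t) z <= CR_of_Q R 4 * e }).
  { intros z e He Hz Hx Hy. apply Turn, Q3; [exact He | apply Circ, Hz | exact Hy |].
    change (- Cre z <= e). lin Hx. }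
  intros z Hz e He.
  assert (P := half_pi_pos).
  assert (Fin : forall b : X, b <= half_pi + half_pi + half_pi + half_pi ->
    { t : X | 0 <= t /\ t <= b /\ dist (s:=plane) (cis t) z <= CR_of_Q R 4 * (e * CR_of_Q R (1#4)) } ->
    { t : interval 0 two_pi | dist z (upsilon t) <= e }).
  { intros b Hb [t [H1 [H2 H3]]].
    assert (Ht : 0 <= t <= two_pi).
    { split; [exact H1|]. apply (CRle_trans _ _ _ (CRle_trans _ _ _ H2 Hb)).
      apply CReq_le. unfold two_pi, half_pi. ring. }
    exists (existT _ t Ht). rewrite (dist_sym _ plane_metric). unfold upsilon. cbn [param projT1].
    lin H3. }
  assert (He4 : 0 < e * CR_of_Q R (1#4)).
  { apply CRmult_lt_0_compat; [exact He | apply CR_of_Q_lt; reflexivity]. }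
  assert (Hee : - (e * CR_of_Q R (1#4)) < e * CR_of_Q R (1#4)).
  { apply (CRlt_of_diff _ _ _ (half_pos e He)). ring. }
  destruct (CRcotrans _ _ (Cre z) Hee) as [Hx|Hx]; apply CRlt_asym in Hx;
  destruct (CRcotrans _ _ (Cim z) Hee) as [Hy|Hy]; apply CRlt_asym in Hy; apply CRlt_asym in He4.
  - apply (Fin half_pi); [lin (3%Q, P) | apply first_quadrant; assumption].
  - apply (Fin (half_pi + half_pi + half_pi + half_pi)); [apply CRle_refl | apply Q4; assumption].
  - apply (Fin (half_pi + half_pi)); [lin (2%Q, P) | apply Q2; assumption].
  - apply (Fin (half_pi + half_pi + half_pi)); [lin P | apply Q3; assumption].
Qed.

Lemma unit_circle_closure : forall z : @plane R, unit_circle z -> closure (image upsilon) z.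
Proof.
  intros z Hz e He. unfold unit_circle in Hz.
  destruct (on_circle_approx z) with (e := e * CR_of_Q R (1#2)) as [t Ht].
  - unfold on_circle. rewrite <- Cabs_sq, Hz. ring.
  - apply half_pos, He.
  - exists (upsilon t).
    + exists t. apply (dist_refl _ plane_metric).
    + apply (CRle_lt_trans _ _ _ Ht). apply (CRlt_of_diff _ _ _ (half_pos e He)). ring.
Qed.

Lemma closure_unit_circle : forall z : @plane R, closure (image upsilon) z -> unit_circle z.
Proof.
  assert (Habs : forall z : @plane R, dist (s:=plane) z (0, 0) == Cabs z).
  { intro z. apply CRsq_inj; [apply (dist_nonneg _ plane_metric) | apply Cabs_nonneg|].
    rewrite plane_dist_sq, Cabs_sq, CreE, CimE. ring. }
  assert (H1 : forall t : X, Cabs (cis t) == 1).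
  { intro t. apply CRsq_inj; [apply Cabs_nonneg | apply CR_of_Q_nonneg; reflexivity|].
    rewrite Cabs_sq. fold (CRcos t) (CRsin t). rewrite CRcos_sin_sq. ring. }
  intros z Hz. unfold unit_circle. rewrite <- Habs.
  split; apply CRle_all_pos; intros e He;
    destruct (closure_image_point plane_metric _ _ Hz e He) as [t Ht];
    assert (K0 := H1 (param t)); change (cis (param t)) with (upsilon t) in K0.
  - assert (K := dist_tri _ plane_metric (upsilon t) z (0, 0)).
    rewrite (Habs (upsilon t)), K0, (dist_sym _ plane_metric (upsilon t)) in K. lin (K, Ht).
  - assert (K := dist_tri _ plane_metric z (upsilon t) (0, 0)).
    rewrite (Habs (upsilon t)), K0 in K. lin (K, Ht).
Qed.

(** * The parametrization [upsilon] as a closed path *)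

Lemma upsilon_same_ends : forall H : 0 <= two_pi,
  same (upsilon (R:=R) (left_end H)) (upsilon (right_end H)).
Proof.
  intro H. apply CRsq_inj; [apply (dist_nonneg _ plane_metric) | apply CRle_refl|].
  rewrite plane_dist_sq. unfold upsilon. cbn [param left_end right_end projT1].
  fold (CRcos (R:=R) 0) (CRsin 0) (CRcos (R:=R) two_pi) (CRsin two_pi).
  destruct (cos_sin_two_pi) as [H1 H2]. rewrite H1, H2, CRcos_0, CRsin_0. ring.
Qed.

Lemma interval_dist_le : forall {a b : X} (s t : interval a b), dist s t <= b - a.
Proof.
  intros a b [s [H1 H2]] [t [H3 H4]]. cbn. apply CRabs_le. split; [lin (H1, H4) | lin (H2, H3)].
Qed.

Lemma upsilon_unif_cont : unif_cont (upsilon (R:=R)).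
Proof.
  intros e He. destruct (cis_lipschitz) as [L [HL H]].
  (* [L] is only nonnegative, so [L + 1] is inverted. *)
  assert (HL1 : 0 < L + 1).
  { apply (CRlt_le_trans _ 1); [apply CR_of_Q_lt; reflexivity | lin HL]. }
  exists (e * CRinv R (L + 1) (inr HL1)).
  { apply CRmult_lt_0_compat; [exact He | apply CRinv_0_lt_compat, HL1]. }
  intros s t Hst. assert (K := interval_dist_le s t).
  assert (K1 := H (param s) (param t)).
  change (dist s t) with (CRabs R (param s - param t)) in Hst, K.
  assert (K2 : CRabs R (param s - param t) <= two_pi) by lin K.
  apply (CRle_trans _ _ _ (K1 K2)).
  assert (K3 := CRmult_le_compat_l _ _ _ (CRlt_asym _ _ HL1) Hst).
  assert (E : (L + 1) * (e * CRinv R (L + 1) (inr HL1)) == e * (CRinv R (L + 1) (inr HL1) * (L + 1))) by ring.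
  rewrite E, CRinv_l in K3. assert (K4 := CRabs_pos (param s - param t)). lin (K3, K4).
Qed.

(* A short chord means that the arguments are close, or near opposite ends of
   the parameter interval, where a closed map takes close values. *)
Lemma upsilon_refines : forall {T : space R}, metric T ->
  forall sigma : interval 0 two_pi -> T, unif_cont sigma ->
  (forall H : 0 <= two_pi, same (sigma (left_end H)) (sigma (right_end H))) ->
  refines (upsilon (R:=R)) sigma.
Proof.
  intros T HT sigma UC Hclosed e He.
  destruct (UC _ (half_pos e He)) as [w Hw Hsig].
  assert (Hw2 := half_pos w Hw).
  (* Parameters at a distance between w/2 and 2pi - w/2 have a chord of at least w/4 by
     [cis_dist_lower]; w/8 excludes them. *)
  exists (w * CR_of_Q R (1#2) * CR_of_Q R (1#2) * CR_of_Q R (1#2)).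
  { apply half_pos, half_pos, Hw2. }
  intros s t Hst.
  destruct (CRcotrans (w * CR_of_Q R (1#2)) w (dist s t)) as [Hd|Hd].
  { apply (CRlt_of_diff _ _ _ Hw2). ring. }
  - destruct (CRcotrans (two_pi - w) (two_pi - w * CR_of_Q R (1#2)) (dist s t)) as [Hd'|Hd'].
    { apply (CRlt_of_diff _ _ _ Hw2). ring. }
    + assert (H0 : 0 <= two_pi (R:=R)).
      { apply (CRle_trans _ (param s)); apply (projT2 s). }
      assert (Hnear : forall t, near_end w t ->
        dist (sigma (left_end H0)) (sigma t) <= e * CR_of_Q R (1#2)).
      { apply (near_end_dist H0 HT sigma (Hclosed H0) w); [|exact Hsig].
        apply CRlt_asym, half_pos, He. }
      assert (Hpair : forall s t : interval 0 two_pi, two_pi - w <= param s - param t ->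
        dist (sigma s) (sigma t) <= e).
      { intros [s0 [H1 H2]] [t0 [H3 H4]] H. cbn in H.
        apply (CRle_trans _ _ _ (dist_tri _ HT _ (sigma (left_end H0)) _)).
        rewrite (dist_sym _ HT (sigma (existT _ s0 (conj H1 H2)))).
        assert (Ns : near_end w (existT _ s0 (conj H1 H2) : interval 0 two_pi)).
        { right. cbn. lin (H, H3). }
        assert (Nt : near_end w (existT _ t0 (conj H3 H4) : interval 0 two_pi)).
        { left. cbn. lin (H, H2). }
        assert (K1 := Hnear _ Ns). assert (K2 := Hnear _ Nt). lin (K1, K2). }
      change (dist s t) with (CRabs R (param s - param t)) in Hd'.
      apply (CRle_cases _ _ (param t) (param s)); intro Hts.
      * apply Hpair. rewrite CRabs_right in Hd'; [lin Hd' | lin Hts].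
      * rewrite (dist_sym _ HT). apply Hpair.
        rewrite CRabs_minus_sym, CRabs_right in Hd'; [lin Hd' | lin Hts].
    + exfalso.
      assert (K : w * CR_of_Q R (1#2) * CR_of_Q R (1#2) <= dist (upsilon s) (upsilon t)).
      { change (dist s t) with (CRabs R (param s - param t)) in Hd, Hd'.
        apply (CRle_cases _ _ (param t) (param s)); intro Hts.
        - rewrite CRabs_right in Hd, Hd'; [|lin Hts|lin Hts].
          apply cis_dist_lower; apply CRlt_asym; assumption.
        - rewrite CRabs_minus_sym, CRabs_right in Hd, Hd'; [|lin Hts|lin Hts].
          rewrite (dist_sym _ plane_metric).
          apply cis_dist_lower; apply CRlt_asym; assumption. }
      assert (K0 : w <= 0) by lin ((8%Q, K), (8%Q, Hst)). exact (K0 Hw).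
  - apply (CRle_trans _ (e * CR_of_Q R (1#2))); [|lin ((1#2)%Q, He)].
    apply Hsig, CRlt_asym, Hd.
Qed.

End JordanCurves.

Theorem theorem18 (R : ConstructiveReals)
  (gamma : interval 0 (@two_pi R) -> @plane R)
  (Hgamma : jordan_curve gamma) :
  { f : subspace (image (@upsilon R)) -> subspace (image gamma) &
    ((forall (z : subspace (image (@upsilon R))) (t : interval 0 (@two_pi R)),
        same (projT1 z) (upsilon t) -> same (projT1 (f z)) (gamma t))
     * unif_bijection f
     * { F : subspace (@unit_circle R) -> subspace (car gamma) &
         ((forall (z : subspace (image (@upsilon R))) (w : subspace (@unit_circle R)),
             same (projT1 w) (projT1 z) -> same (projT1 (F w)) (projT1 (f z)))
          * unif_bijection F)%type })%type }.
Proof.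
  assert (UC := path_unif_cont _ (jordan_path _ Hgamma)).
  assert (Hug : refines upsilon gamma).
  { apply (upsilon_refines plane_metric gamma UC). intro H.
    apply (jordan_closed _ Hgamma); reflexivity. }
  assert (Hgu : refines gamma upsilon).
  { apply (jordan_refines gamma Hgamma plane_metric upsilon upsilon_unif_cont upsilon_same_ends). }
  assert (Hf := image_map_follows plane_metric plane_metric upsilon gamma Hug).
  assert (Hg := image_map_follows plane_metric plane_metric gamma upsilon Hgu).
  exists (image_map plane_metric upsilon gamma). split; [split|].
  (* The parameter stored in [z] may differ from [t]; [follows] at distance 0 shows that the value
     does not depend on it. *)
  - intros z t Hzt. apply CReq0_all_pos; [apply (dist_nonneg _ plane_metric)|].
    intros e He. destruct (Hf e He) as [d Hd H]. apply H. unfold same in Hzt. rewrite Hzt.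
    apply CRlt_asym, Hd.
  - apply (follows_unif_bijection plane_metric plane_metric upsilon gamma _ _ _
      (image_map plane_metric gamma upsilon)); [| |exact Hf|exact Hg];
      apply (image_closure plane_metric).
  - destruct (closure_extension plane_metric plane_metric plane_complete upsilon gamma Hug
      unit_circle (car gamma) unit_circle_closure (fun y H => H)) as [F HF].
    destruct (closure_extension plane_metric plane_metric plane_complete gamma upsilon Hgu
      (car gamma) unit_circle (fun y H => H) closure_unit_circle) as [G HG].
    exists F. split.
    + intros z w Hwz.
      apply (follows_compatible plane_metric plane_metric upsilon gamma _ _ _ _ F
        (image_map plane_metric upsilon gamma) unit_circle_closure HF Hf _ _ Hwz).
    + apply (follows_unif_bijection plane_metric plane_metric upsilon gamma _ _ F G
        unit_circle_closure (fun y H => H) HF HG).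
Qed.
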